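(* Suppose that either (1) $\mathcal X$ is bounded (in which case set $\gamma_0:=0$), or (2) there exists $\gamma_0>0$ such that for every $x\in\mathcal X_0$ the trajectory $X(t;x)$ is well defined for all $t\le 0$ and there is $C=C(x)>0$ with $e^{\gamma_0 t}|h(X(t;x))|\le C$ for all $t\le 0$. Suppose also that there exists a non-negative integer $m$ such that the map $H:\mathcal X\to\mathbb R^m$, $H(x)=(h(x),L_fh(x),\dots,L_f^{m-1}h(x))$, exists and is injective. Let $\gamma>\gamma_0$ with $\alpha+\gamma>0$. Then the operator $$T:\mathcal X\times L^2(0,1)\to L^2(0,1),\qquad T(x,v)=T_0(x)+\mathbb Tv,$$ is injective when restricted to $\mathcal X\times\mathcal A$.
   Context: Setting. $\alpha\in\mathbb R$; $f:\mathbb R^n\to\mathbb R^n$ and $h:\mathbb R^n\to\mathbb R$ are (nonlinear) maps with $h$ continuous; $\mathcal X_0\subset\mathbb R^n$ is an open set such that for every $x_0\in\mathcal X_0$ the Cauchy problem $\dot x=f(x)$, $x(0)=x_0$ has a unique forward complete solution, denoted $t\mapsto X(t;x_0)$. $\mathcal X:=\{X(t;x_0): x_0\in\mathcal X_0,\ t\ge0\}$. $L_f^kh$ is the $k$-th iterated Lie derivative of $h$ along $f$. $L^2(0,1)$ consists of real-valued functions; the variable in $[0,1]$ is denoted $\lambda$. Space $\mathcal A$. $\mathcal A$ is the space of real-analytic functions $v\in L^2(0,1)$ (analytic up to and including the endpoint $\lambda=0$) such that $\frac{d^{2k+1}v}{d\lambda^{2k+1}}(0)=0$ for all $k\in\mathbb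 N$. Backstepping transform. $\mathbb T:L^2(0,1)\to L^2(0,1)$, $(\mathbb Tv)(\lambda)=v(\lambda)-\int_0^\lambda p(\lambda,\tilde\lambda)v(\tilde\lambda)\,d\tilde\lambda$, where, for $0\le\tilde\lambda\le\lambda\le1$, $$p(\lambda,\tilde\lambda)=(\alpha+\gamma)(1-\lambda)\frac{J_1\big(\sqrt{(\alpha+\gamma)(\tilde\lambda^2-\lambda^2+2(\lambda-\tilde\lambda))}\big)}{\sqrt{(\alpha+\gamma)(\tilde\lambda^2-\lambda^2+2(\lambda-\tilde\lambda))}},$$ $J_1$ is the Bessel function of the first kind of order 1, and $J_1(s)/s$ is understood as $1/2$ at $s=0$. The kernel $p$ is analytic and is the unique solution of $p_{\lambda\lambda}-p_{\tilde\lambda\tilde\lambda}=(\alpha+\gamma)p$, $\frac{d}{d\lambda}\big(p(\lambda,\lambda)\big)=-(\alpha+\gamma)/2$, $p(1,\tilde\lambda)=0$. KKL map $T_0$. For $u\in C^0((-\infty,0])$ such that $t\mapsto e^{\gamma t}u(t)$ is bounded on $(-\infty,0]$, $w_u$ denotes the unique solution $w_u\in C^1((-\infty,0],C^2([0,1]))$ of $$\partial_tw_u(t,\lambda)=\partial_\lambda^2w_u(t,\lambda)-\gamma w_u(t,\lambda),\quad \partial_\lambda w_u(t,0)=0,\quad w_u(t,1)=u(t)\qquad(t\le0,\ \lambda\in[0,1])$$ for which there is $C>0$ with $\|w_u(t,\cdot)\|_{L^2(0,1)}<Ce^{-\gamma t}$ for all $t\le0$. In case (1) ($\mathcal X$ bounded),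 to define backward trajectories, $f$ is replaced by $\chi f$, where $\chi f=f$ on $\mathcal X$ and $\chi=0$ outside a bounded open set containing the closure of $\mathcal X$ (this does not change the forward trajectories of interest and keeps backward trajectories in a compact set); the modified field is still denoted $f$ and $X(t;x)$, $t\le0$, is its backward trajectory. For $x\in\mathcal X$ put $u_x(t):=-h(X(t;x))$ for $t\le0$, and $T_0(x,\lambda):=w_{u_x}(0,\lambda)$, $\lambda\in[0,1]$; $T_0(x)$ denotes the function $T_0(x,\cdot)$.
   Formalization: The existence of the classical solution w_u is assumed for the inputs u = u_x, x in 𝒳, since for merely continuous u it can fail (w_u(t,1) = u(t) forces u to be C^1) and T_0 would then be undefined. *)

(* Defs.v *)
From HB Require Import structures.
From mathcomp Require Import all_boot all_order all_algebra.
From mathcomp Require Import all_classical all_reals all_analysis.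

Set Implicit Arguments.
Unset Strict Implicit.
Unset Printing Implicit Defensive.

Import Order.TTheory GRing.Theory Num.Theory.
Import numFieldNormedType.Exports.

Local Open Scope classical_set_scope.
Local Open Scope ring_scope.

Section DerivativeWithin.
Context {R : realType} {V : normedModType R}.

(* Derivative relative to I: one-sided at an endpoint belonging to I. *)
Definition quotient_in (I : set R) (phi : R -> V) (t : R) :=
  (fun s => (s - t)^-1 *: (phi s - phi t)) @ within I t^'.

Definition has_derive_in (I : set R) (phi : R -> V) (t : R) (d : V) : Prop :=
  quotient_in I phi t --> d.

Definition derive_in (I : set R) (phi : R -> V) (t : R) : V :=
  lim (quotient_in I phi t).

(* phi' = f(phi) on I, phi(0) = x *)
Definition cauchy_solution (f : V -> V) (I : set R) (x : V) (phi : R -> V) :=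
  phi 0 = x /\ forall t, I t -> has_derive_in I phi t (f (phi t)).

Definition unique_cauchy_solution (f : V -> V) (I : set R) (x : V)
    (phi : R -> V) :=
  cauchy_solution f I x phi /\
  forall psi, cauchy_solution f I x psi -> {in I, psi =1 phi}.

End DerivativeWithin.

Section Trajectories.
Context {R : realType} {n : nat}.
Implicit Types (f g : 'rV[R]_n -> 'rV[R]_n) (h : 'rV[R]_n -> R).

Definition reachable (X0 : set 'rV[R]_n) (X : R -> 'rV[R]_n -> 'rV[R]_n) : set 'rV[R]_n :=
  [set X t x | t in `[0, +oo[ & x in X0].

(* X t x0 solves the ODE of f forward in time and that of g backward in time.
   The last clause is what X(t; x), t <= 0, means at a reachable point
   x = X(s; x0); it expresses that this does not depend on (s, x0). *)
Definition trajectories f g (X0 : set 'rV[R]_n)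
    (X : R -> 'rV[R]_n -> 'rV[R]_n) : Prop :=
  [/\ forall x0, X0 x0 -> unique_cauchy_solution f `[0, +oo[ x0 (X^~ x0),
      forall x0, X0 x0 -> unique_cauchy_solution g `]-oo, 0] x0 (X^~ x0)
    & forall x0 (s t : R), X0 x0 -> 0 <= s -> t <= 0 ->
        X t (X s x0) = X (t + s) x0].

Definition cutoff_field f (S : set 'rV[R]_n) g : Prop :=
  exists (chi : 'rV[R]_n -> R) (U : set 'rV[R]_n),
    [/\ open U, bounded_set U & closure S `<=` U] /\
    [/\ forall x, S x -> chi x *: f x = f x,
        forall x, ~ U x -> chi x = 0
      & g = fun x => chi x *: f x].

Definition lie_derive f h : 'rV[R]_n -> R := fun x => 'd h x (f x).

(* L_f^k h makes sense at x: L_f^(k-1) h makes sense around x and is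
   differentiable at x. *)
Fixpoint lie_defined f h (k : nat) (x : 'rV[R]_n) : Prop :=
  if k is k'.+1 then
    (\forall y \near x, lie_defined f h k' y) /\
    differentiable (iter k' (lie_derive f) h) x
  else True.

Definition lie_map f h (m : nat) (x : 'rV[R]_n) : 'rV[R]_m :=
  \row_(k < m) iter k (lie_derive f) h x.

End Trajectories.

Section FunctionSpaces.
Context {R : realType}.
Implicit Types (v : R -> R) (w : R -> R -> R).

(* L^2(0,1) is represented by functions R -> R considered on ]0, 1[ only, up to
   almost everywhere equality there. *)
Definition L2 v : Prop :=
  v \_ `]0, 1[ \in Lfun (@lebesgue_measure R) 2%:E.

Definition L2norm v : \bar R :=
  'N[@lebesgue_measure R]_2%:E [EFin \o (v \_ `]0, 1[)].

Definition analytic_on (I : set R) v : Prop :=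
  forall l0, I l0 -> exists (a : nat -> R) (r : R), 0 < r /\
    forall l, I l -> `|l - l0| < r ->
      series (fun k => a k * (l - l0) ^+ k) @ \oo --> v l.

Definition spaceA : set (R -> R) :=
  [set v | [/\ L2 v, analytic_on `[0, 1[ v
    & forall k : nat, iter k.*2.+1 (derive_in `[0, 1[) v 0 = 0]].

Definition derive_01 : (R -> R) -> R -> R := derive_in `[0, 1].

Definition C2_01 v : Prop :=
  [/\ forall l : R, l \in `[0, 1] -> has_derive_in `[0, 1] v l (derive_01 v l),
      forall l : R, l \in `[0, 1] ->
        has_derive_in `[0, 1] (derive_01 v) l (derive_01 (derive_01 v) l)
    & {within `[0, 1], continuous (derive_01 (derive_01 v))}].

Definition supnorm_01 v : R := sup [set `|v l| | l in `[0, 1]].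

Definition C2norm_01 v : R :=
  supnorm_01 v + supnorm_01 (derive_01 v) +
  supnorm_01 (derive_01 (derive_01 v)).

(* w is in C^1(]-oo, 0], C^2([0, 1])), with time derivative dw: limits are taken
   in the Banach space C^2([0, 1]). *)
Definition C1_C2 w (dw : R -> R -> R) : Prop :=
  forall t : R, t <= 0 ->
    [/\ C2_01 (w t), C2_01 (dw t),
        C2norm_01 (fun l => (s - t)^-1 * (w s l - w t l) - dw t l)
          @[s --> within `]-oo, 0] t^'] --> (0 : R)
      & C2norm_01 (fun l => dw s l - dw t l)
          @[s --> within `]-oo, 0] (nbhs t)] --> (0 : R)].

Definition heat_solution (gamma : R) (u : R -> R) w : Prop :=
  (exists dw, C1_C2 w dw /\
    forall t : R, t <= 0 ->
      [/\ forall l : R, l \in `[0, 1] ->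
            dw t l = derive_01 (derive_01 (w t)) l - gamma * w t l,
          derive_01 (w t) 0 = 0
        & w t 1 = u t]) /\
  exists2 C : R, 0 < C &
    forall t : R, t <= 0 -> (L2norm (w t) < (C * expR (- gamma * t))%:E)%E.

End FunctionSpaces.

Section Observer.
Context {R : realType}.

Definition besselJ1 (s : R) : R :=
  limn (series (fun k : nat =>
    (-1) ^+ k / (k`! * (k.+1)`!)%:R * (s / 2) ^+ k.*2.+1)).

Definition besselJ1_ratio (s : R) : R :=
  if s == 0 then 2^-1 else besselJ1 s / s.

(* c = alpha + gamma *)
Definition backstepping_kernel (c l l' : R) : R :=
  c * (1 - l) *
  besselJ1_ratio (Num.sqrt (c * (l' ^+ 2 - l ^+ 2 + 2 * (l - l')))).

Definition backstepping (c : R) (v : R -> R) : R -> R := fun l =>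
  v l - \int[@lebesgue_measure R]_(l' in `[0, l])
          (backstepping_kernel c l l' * v l').

Context {n : nat}.

Definition kkl_input (h : 'rV[R]_n -> R) (X : R -> 'rV[R]_n -> 'rV[R]_n)
    (x : 'rV[R]_n) : R -> R := fun t => - h (X t x).

(* For t <= 0 and l in [0, 1] the value does not depend on the choice made by
   xget, since the solution is unique there. *)
Definition kkl_map (gamma : R) (h : 'rV[R]_n -> R)
    (X : R -> 'rV[R]_n -> 'rV[R]_n) (x : 'rV[R]_n) : R -> R :=
  xget (fun _ _ => 0) [set w | heat_solution gamma (kkl_input h X x) w] 0.

Definition observer_map (alpha gamma : R) (h : 'rV[R]_n -> R)
    (X : R -> 'rV[R]_n -> 'rV[R]_n) (x : 'rV[R]_n) (v : R -> R) : R -> R :=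
  fun l => kkl_map gamma h X x l + backstepping (alpha + gamma) v l.

End Observer.

(* Main.v *)
Require Import Defs.
From mathcomp Require Import all_boot all_order all_algebra.
From mathcomp Require Import all_classical all_reals all_analysis.
From mathcomp Require Import ring lra.
Import Order.TTheory GRing.Theory Num.Theory.
Import numFieldNormedType.Exports.
Local Open Scope classical_set_scope.
Local Open Scope ring_scope.

Set Implicit Arguments.
Unset Strict Implicit.
Unset Printing Implicit Defensive.

(** Let [w] be the difference of the two heat solutions and [v = va - vb], so that
[w 0 = - T v], where [T] is the backstepping transform. Two pairings of [w] with
solutions [P] of the adjoint heat equation, both Neumann at [0], are used; the
derivative in time of [exp (gamma t) * int_0^r w P] only involves boundary terms
at [l = r].

First, take for [P] a [2k + 2]-nd space derivative of the heat kernel, singular at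
the time [eps > 0]. As [eps] tends to [0] the pairing at [t = 0] stays bounded,
because the kernel is smooth away from [l = 0]; but a term [b' l^(2k+1)] in the
expansion of [w 0] at [l = 0] would contribute a multiple of [b' eps^(-1/2)].
Hence [w 0 = - b l^(2k) + b' l^(2k+1) + O(l^(2k+2))] forces [b' = 0]. If [v] vanishes to the exact order
[2k] at [0], with coefficient [b], then [T v] has at order [2k + 1] the coefficient
[- (c / 2) b / (2k + 1)], since [p(0, 0) = c / 2]. So [b = 0], and [v = 0] by the
identity theorem.

Then [w 0 = 0], and [P = exp (m^2 t) cos (m l)] with [m = (k + 1/2) pi] shows that
the trace [w(t, 1)] cannot keep a strict sign on an interval [-d < t < 0]. The
trace is [h] along one trajectory minus [h] along the other, so the first of its
derivatives [L_f^j h] at [0] that differs between the two would force such a sign. *)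

(** * One-sided derivatives *)

(** The Neumann condition kills the first odd derivative of [w 0] at the origin. The higher ones
    would require differentiating the equation in time, but [w] is only once differentiable in time
    with values in C^2, so their vanishing is tested weakly, against a singular kernel.

    With [s = eps^(-1/2)], scaling suggests that [l^i] paired with the kernel derivative of order
    [2k + 2] has size [s^(2k + 2 - i)]. The even term [l^(2k)], apparently of size [s^2], in fact
    contributes a bounded amount: integrating by parts down to order one leaves at the origin an odd
    derivative of an even function, which is zero. For [l^(2k+1)] the integrations end at the kernel
    itself, whose value at the origin is [s], so this term alone diverges.

    In the second pairing [cos m = 0] removes the unknown flux of [w] at [l = 1] and leaves only the
    trace. Both pairings stay in the time window [-1 <= t <= 0]. *)

Section FirstOrderExpansion.
Context {R : realType} {V : normedModType R}.
Implicit Types (I : set R) (f : R -> V) (t : R) (d : V).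

(** Division-free form of the limit of difference quotients. The point [s = t] need not be excluded,
    and one-sided and two-sided derivatives obey the same calculus rules. *)
Definition expansion_in I f t d := forall e : R, 0 < e ->
  exists2 r : R, 0 < r & forall s, I s -> `|s - t| < r ->
    `|f s - f t - (s - t) *: d| <= e * `|s - t|.

Lemma has_derive_inP I f t d : has_derive_in I f t d <-> expansion_in I f t d.
Proof.
rewrite /has_derive_in /quotient_in; split.
- move=> /cvgrPdist_le fd e e0; have := fd e e0.
  move=> /nbhs_ballP[r /= r0 H]; exists r => // s Is str.
  have [->|st] := eqVneq s t.
    by rewrite !subrr scale0r subrr !normr0 mulr0.
  have bs : ball t r s by rewrite /ball /= distrC.
  have := H s bs st Is.
  have st0 : 0 < `|s - t| by rewrite normr_gt0 subr_eq0.
  rewrite -(ler_pM2r st0); apply: le_trans; rewrite mulrC -normrZ.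
  by rewrite scalerBr scalerA divff ?subr_eq0// scale1r distrC.
- move=> H; apply/cvgrPdist_le => e e0; have [r r0 Hr] := H e e0.
  apply/nbhs_ballP; exists r => // s; rewrite /ball /= distrC => sr st Is.
  have st0 : 0 < `|s - t| by rewrite normr_gt0 subr_eq0.
  rewrite -(ler_pM2l st0) -normrZ mulrC (le_trans _ (Hr s Is sr))//.
  by rewrite scalerBr scalerA divff ?subr_eq0// scale1r distrC.
Qed.

Lemma is_derive_expansion f t d : is_derive t 1 f d <-> expansion_in setT f t d.
Proof.
split.
- move=> [df fd] e e0.
  move: df; rewrite /derivable => /(cvg_ex _) [l lP].
  have := lP; move=> /(cvg_lim _) => /(_ (@norm_hausdorff _ _)).
  rewrite -[lim _]/('D_1 f t) fd => ld; move: lP; rewrite -ld => {ld fd}.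
  move=> /cvgrPdist_le/(_ e e0)/nbhs_ballP[r /= r0 H]; exists r => // s _ str.
  have [->|st] := eqVneq s t.
    by rewrite !subrr scale0r subrr !normr0 mulr0.
  have st0 : 0 < `|s - t| by rewrite normr_gt0 subr_eq0.
  have bs : ball (0 : R) r (s - t) by rewrite /ball /= sub0r normrN.
  have := H (s - t) bs; rewrite subr_eq0 => /(_ st) /=.
  rewrite -(ler_pM2r st0); apply: le_trans; rewrite mulrC -normrZ.
  rewrite scalerBr scalerA divff ?subr_eq0// scale1r distrC.
  by rewrite -[(s - t) *: 1]/((s - t) * 1) mulr1 subrK.
- move=> H; have cf : (h^-1 *: (f (h *: 1 + t) - f t)) @[h --> 0^'] --> d.
    apply/cvgrPdist_le => e e0; have [r r0 Hr] := H e e0.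
    apply/nbhs_ballP; exists r => // h; rewrite /ball /= sub0r normrN => hr h0.
    have st0 : 0 < `|h| by rewrite normr_gt0.
    have := Hr (h + t) I; rewrite addrK => /(_ hr) K.
    rewrite -(ler_pM2l st0) -normrZ [leRHS]mulrC; apply: le_trans K.
    rewrite scalerBr scalerA divff// scale1r distrC.
    by rewrite -[h *: 1]/(h * 1) mulr1.
  split; last exact: (cvg_lim (@norm_hausdorff _ _) cf).
  by apply/cvg_ex; exists d.
Qed.

Lemma expansion_inW (I J : set R) f t d r : 0 < r ->
  (forall s, J s -> `|s - t| < r -> I s) -> expansion_in I f t d ->
  expansion_in J f t d.
Proof.
move=> r0 JI H e e0; have [r' r'0 Hr'] := H e e0.
exists (Num.min r r'); first by rewrite lt_min r0.
by move=> s Js; rewrite lt_min => /andP[sr sr']; apply: Hr' => //; exact: JI.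
Qed.

Lemma expansion_in_cvg I f t d : expansion_in I f t d ->
  forall e : R, 0 < e -> exists2 r : R, 0 < r & forall s, I s -> `|s - t| < r ->
    `|f s - f t| <= e.
Proof.
move=> H e e0; have [r r0 Hr] := H 1 ltr01.
have d0 : 0 < `|d| + 1 by rewrite ltr_wpDl.
exists (Num.min r (e / (`|d| + 1))).
  by rewrite lt_min r0 divr_gt0.
move=> s Is; rewrite lt_min => /andP[sr se].
have := Hr s Is sr; rewrite mul1r => K.
rewrite -(subrK ((s - t) *: d) (f s - f t)) (le_trans (ler_normD _ _))//.
rewrite normrZ; move: se; rewrite ltr_pdivlMr// => /ltW; apply: le_trans.
by rewrite mulrDr mulr1 addrC lerD2l.
Qed.

(** The first hypothesis makes [t] a limit point of [I]; at an isolated point every [d] would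
    satisfy the expansion. *)
Lemma expansion_in_unique I f t d d' :
  (forall r : R, 0 < r -> exists2 s, I s & 0 < `|s - t| < r) ->
  expansion_in I f t d -> expansion_in I f t d' -> d = d'.
Proof.
move=> It H H'; apply/eqP; rewrite -subr_eq0 -normr_le0.
apply/ler_addgt0Pl => e e0; rewrite addr0.
have e20 : 0 < e / 2 by rewrite divr_gt0.
have [r r0 Hr] := H _ e20; have [r' r'0 Hr'] := H' _ e20.
have [|s Is /andP[s0]] := It (Num.min r r'); first by rewrite lt_min r0.
rewrite lt_min => /andP[sr sr'].
have := lerD (Hr s Is sr) (Hr' s Is sr').
rewrite -mulrDl -splitr => K.
rewrite -(ler_pM2r s0) mulrC -normrZ; apply: le_trans K.
rewrite -[X in _ <= _ + X]normrN -[leLHS]normrN; apply: le_trans (ler_normD _ _).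
rewrite le_eqVlt; apply/orP; left; apply/eqP; congr `|_|.
by move: (f s - f t) => A; rewrite scalerBr !opprB [RHS]addrC addrA subrK.
Qed.

End FirstOrderExpansion.

Section RealExpansion.
Context {R : realType}.
Implicit Types (I : set R) (f g : R -> R).

Lemma expansion_inB I f g t d d' : expansion_in I f t d ->
  expansion_in I g t d' -> expansion_in I (fun s => f s - g s) t (d - d').
Proof.
move=> H H' e e0.
have e20 : 0 < e / 2 by rewrite divr_gt0.
have [r r0 Hr] := H _ e20; have [r' r'0 Hr'] := H' _ e20.
exists (Num.min r r'); first by rewrite lt_min r0.
move=> s Is; rewrite lt_min => /andP[sr sr'].
have := lerD (Hr s Is sr) (Hr' s Is sr').
rewrite -mulrDl -splitr; apply: le_trans.
rewrite -[X in _ <= _ + X]normrN; apply: le_trans (ler_normD _ _).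
rewrite le_eqVlt; apply/orP; left; apply/eqP; congr `|_|.
by rewrite /GRing.scale /=; ring.
Qed.

Lemma expansion_inZ I f t d (c : R) : expansion_in I f t d ->
  expansion_in I (fun s => c * f s) t (c * d).
Proof.
move=> H e e0; have c0 : 0 < `|c| + 1 by rewrite ltr_wpDl.
have [r r0 Hr] := H _ (divr_gt0 e0 c0); exists r => // s Is sr.
have -> : c * f s - c * f t - (s - t) *: (c * d) =
  c * (f s - f t - (s - t) *: d) by rewrite /GRing.scale /=; ring.
rewrite normrM; apply: (le_trans (ler_wpM2l (normr_ge0 c) (Hr s Is sr))).
rewrite mulrA ler_wpM2r// mulrCA; apply: ler_piMr; first exact: ltW.
by rewrite ler_pdivrMr // mul1r lerDl.
Qed.

Lemma expansion_in_continuous I f :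
  (forall t, I t -> exists d, expansion_in I f t d) -> {within I, continuous f}.
Proof.
move=> H; apply/subspace_continuousP => t It; apply/cvgrPdist_le => e e0.
have [d /expansion_in_cvg /(_ e e0)[r r0 Hr]] := H t It.
by apply/nbhs_ballP; exists r => // s; rewrite /ball /= distrC => sr Is; rewrite distrC Hr.
Qed.

Lemma within_continuous_dist I f t (e : R) : {within I, continuous f} -> I t -> 0 < e ->
  exists2 r : R, 0 < r & forall s, I s -> `|s - t| < r -> `|f s - f t| <= e.
Proof.
move=> /subspace_continuousP cf It e0.
have /cvgrPdist_le/(_ e e0)/nbhs_ballP[r /= r0 H] := cf t It.
exists r => // s Is sr; rewrite distrC; apply: H => //.
by rewrite /ball /= distrC.
Qed.

Lemma within_continuous_bounded f (a b : R) : a <= b ->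
  {within `[a, b], continuous f} ->
  exists2 M : R, 0 < M & forall x, a <= x <= b -> `|f x| <= M.
Proof.
move=> ab cf.
have cnf : {within `[a, b], continuous (fun x => `|f x|)}.
  by move=> x; apply: continuous_comp; [exact: cf | exact: norm_continuous].
have [c _ Hc] := EVT_max ab cnf.
exists (`|f c| + 1); first by rewrite ltr_wpDl.
by move=> x xab; rewrite (le_trans (Hc x _)) ?in_itv// lerDl.
Qed.

End RealExpansion.

(** * Calculus rules, mean values and integrals over segments *)

Section SegmentIntegral.
Context {R : realType}.
Implicit Types (I : set R) (f g F : R -> R) (a b c d t : R).
Local Notation mu := (@lebesgue_measure R).

Lemma normrM_le (x y A B : R) : `|x| <= A -> `|y| <= B -> `|x * y| <= A * B.
Proof. by move=> xA yB; rewrite normrM ler_pM. Qed.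

Lemma normrD_le (x y A B : R) : `|x| <= A -> `|y| <= B -> `|x + y| <= A + B.
Proof. by move=> xA yB; rewrite (le_trans (ler_normD _ _))// lerD. Qed.

Lemma normrB_le (x y A B : R) : `|x| <= A -> `|y| <= B -> `|x - y| <= A + B.
Proof. by move=> xA yB; rewrite (le_trans (ler_normB _ _))// lerD. Qed.

Lemma expansion_inM I f g t d d' : expansion_in I f t d ->
  expansion_in I g t d' ->
  expansion_in I (fun s => f s * g s) t (d * g t + f t * d').
Proof.
move=> Hf Hg e e0.
have A0 : 0 < `|g t| + 1 by rewrite ltr_wpDl.
have B0 : 0 < `|d| + 1 by rewrite ltr_wpDl.
have C0 : 0 < `|f t| + 1 by rewrite ltr_wpDl.
have e30 : 0 < e / 3 by rewrite divr_gt0.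
have [r1 r10 H1] := Hf _ (divr_gt0 e30 A0).
have [r2 r20 H2] := Hg _ (divr_gt0 e30 C0).
have [r3 r30 H3] := expansion_in_cvg Hg (divr_gt0 e30 B0).
have [r4 r40 H4] := expansion_in_cvg Hg ltr01.
exists (Num.min (Num.min r1 r2) (Num.min r3 r4)); first by rewrite !lt_min r10 r20 r30.
move=> s Is; rewrite !lt_min => /andP[/andP[s1 s2] /andP[s3 s4]].
have gs : `|g s| <= `|g t| + 1.
  by rewrite -(subrK (g t) (g s)) (le_trans (ler_normD _ _))// addrC lerD2l H4.
have -> : f s * g s - f t * g t - (s - t) *: (d * g t + f t * d') =
  (f s - f t - (s - t) *: d) * g s + ((s - t) * (d * (g s - g t))
  + f t * (g s - g t - (s - t) *: d')) by rewrite /GRing.scale /=; ring.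
have -> : e * `|s - t| = e / 3 * `|s - t| + (e / 3 * `|s - t| + e / 3 * `|s - t|).
  by field.
apply: (le_trans (ler_normD _ _)); apply: lerD.
  rewrite normrM; apply: (le_trans (ler_pM _ _ (H1 s Is s1) gs)) => //.
  by rewrite mulrAC divfK// gt_eqF.
apply: (le_trans (ler_normD _ _)); apply: lerD.
  rewrite !normrM mulrC ler_wpM2r//.
  apply: (@le_trans _ _ ((`|d| + 1) * (e / 3 / (`|d| + 1)))).
    by apply: ler_pM => //; [rewrite lerDl | exact: H3].
  by rewrite mulrC divfK// gt_eqF.
rewrite normrM; apply: (@le_trans _ _ ((`|f t| + 1) * (e / 3 / (`|f t| + 1) * `|s - t|))).
  by apply: ler_pM => //; [rewrite lerDl | exact: H2].
by rewrite mulrA [X in X * _]mulrC divfK// gt_eqF.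
Qed.

Lemma is_derive_expansion_in I f t d : is_derive t 1 f d -> expansion_in I f t d.
Proof. by move=> /is_derive_expansion; exact: (expansion_inW ltr01). Qed.

Lemma expansion_in_lipschitz I f t d : expansion_in I f t d ->
  exists2 r : R, 0 < r & forall s, I s -> `|s - t| < r ->
    `|f s - f t| <= (`|d| + 1) * `|s - t|.
Proof.
move=> H; have [r r0 Hr] := H 1 ltr01; exists r => // s Is sr.
rewrite -(subrK ((s - t) *: d) (f s - f t)) (le_trans (ler_normD _ _))//.
rewrite mulrDl addrC lerD//; last exact: Hr.
by rewrite normrM mulrC.
Qed.

Lemma expansion_in_comp I (F : R -> R) g t d d' : expansion_in setT F (g t) d' ->
  expansion_in I g t d -> expansion_in I (fun s => F (g s)) t (d' * d).
Proof.
move=> HF Hg e e0.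
have A0 : 0 < `|d| + 1 by rewrite ltr_wpDl.
have B0 : 0 < `|d'| + 1 by rewrite ltr_wpDl.
have e20 : 0 < e / 2 by rewrite divr_gt0.
have [r1 r10 H1] := HF _ (divr_gt0 e20 A0).
have [r2 r20 H2] := Hg _ (divr_gt0 e20 B0).
have [r3 r30 H3] := expansion_in_lipschitz Hg.
exists (Num.min (Num.min r2 r3) (r1 / (`|d| + 1))).
  by rewrite !lt_min r20 r30 divr_gt0.
move=> s Is; rewrite !lt_min => /andP[/andP[s2 s3] s1].
have gs1 : `|g s - g t| < r1.
  by apply: (le_lt_trans (H3 s Is s3)); rewrite mulrC -ltr_pdivlMr.
have -> : F (g s) - F (g t) - (s - t) *: (d' * d) =
  (F (g s) - F (g t) - (g s - g t) *: d') + d' * (g s - g t - (s - t) *: d).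
  by rewrite /GRing.scale /=; ring.
have -> : e * `|s - t| = e / 2 * `|s - t| + e / 2 * `|s - t| by field.
apply: (le_trans (ler_normD _ _)); apply: lerD.
  apply: (le_trans (H1 _ Logic.I gs1)).
  apply: (@le_trans _ _ (e / 2 / (`|d| + 1) * ((`|d| + 1) * `|s - t|))).
    by rewrite ler_wpM2l ?H3// ltW// divr_gt0.
  by rewrite mulrA divfK// gt_eqF.
rewrite normrM; apply: (@le_trans _ _ ((`|d'| + 1) * (e / 2 / (`|d'| + 1) * `|s - t|))).
  by apply: ler_pM => //; [rewrite lerDl | exact: H2].
by rewrite mulrA [X in X * _]mulrC divfK// gt_eqF.
Qed.

Lemma expansion_id I t : expansion_in I (fun s => s) t 1.
Proof.
move=> e e0; exists 1 => // s _ _.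
by rewrite /GRing.scale /= mulr1 subrr normr0 mulr_ge0// ltW.
Qed.

Lemma expansion_cst I (c : R) t : expansion_in I (fun=> c) t 0.
Proof.
move=> e e0; exists 1 => // s _ _.
by rewrite scaler0 subrr subr0 normr0 mulr_ge0// ltW.
Qed.

Lemma expansion_inN I f t d : expansion_in I f t d ->
  expansion_in I (fun s => - f s) t (- d).
Proof.
move=> /(expansion_inZ (-1)).
by congr (expansion_in _ _ _ _); [apply/funext => x|]; rewrite mulN1r.
Qed.

Lemma expansion_inD I f g t d d' : expansion_in I f t d ->
  expansion_in I g t d' -> expansion_in I (fun s => f s + g s) t (d + d').
Proof.
move=> Hf /expansion_inN Hg; have := expansion_inB Hf Hg.
by congr (expansion_in _ _ _ _); [apply/funext => x|]; rewrite opprK.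
Qed.

Lemma expansion_exprn I (i : nat) t :
  expansion_in I (fun s => s ^+ i.+1) t (i.+1%:R * t ^+ i).
Proof.
have := is_derive_poly ('X^(i.+1) : {poly R}) t.
rewrite derivXn /= hornerMn hornerXn -mulr_natl => /is_derive_expansion_in H.
by have := H I; congr (expansion_in _ _ _ _); apply/funext => x; rewrite hornerXn.
Qed.

Lemma expansion_scaled I (F : R -> R) c t d : expansion_in setT F (c * t) d ->
  expansion_in I (fun s => F (c * s)) t (c * d).
Proof.
move=> HF; rewrite mulrC -[X in _ * X]mulr1.
apply: (@expansion_in_comp I F (fun s => c * s)) => //.
exact: expansion_inZ (expansion_id _ _).
Qed.

Lemma expansion_expR I (c : R) t :
  expansion_in I (fun s => expR (c * s)) t (c * expR (c * t)).
Proof. by apply: expansion_scaled; apply: is_derive_expansion_in; exact: is_derive_expR. Qed.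

Lemma expansion_is_derive f a b t d : a < t < b -> expansion_in `[a, b] f t d ->
  is_derive t 1 f d.
Proof.
move=> /andP[at_ tb] H; apply/is_derive_expansion.
apply: (expansion_inW (r := Num.min (t - a) (b - t)) _ _ H).
  by rewrite lt_min !subr_gt0 at_.
move=> s _; rewrite lt_min !ltr_norml /= in_itv /= => /andP[/andP[h1 h2] /andP[h3 h4]].
by apply/andP; split; lra.
Qed.

Lemma expansion_MVT f df a b : a < b ->
  (forall t, a <= t <= b -> expansion_in `[a, b] f t (df t)) ->
  exists2 c, a < c < b & f b - f a = df c * (b - a).
Proof.
move=> ab H.
have [x xab||c cab ->] := @MVT R f df a b ab.
- move: xab; rewrite in_itv /= => xab; apply: (@expansion_is_derive _ a b) => //.
  by apply: H; case/andP: xab => /ltW -> /ltW ->.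
- apply: expansion_in_continuous => x; rewrite /= in_itv /= => xab.
  by exists (df x); exact: H.
- by exists c => //; move: cab; rewrite in_itv.
Qed.

Lemma continuous_integrable_cc f a b : {within `[a, b], continuous f} ->
  mu.-integrable `[a, b] (EFin \o f).
Proof. by move=> cf; apply: continuous_compact_integrable => //; exact: segment_compact. Qed.

Lemma le_Rintegral_cc f a b (M : R) : a <= b -> {within `[a, b], continuous f} ->
  (forall x, a <= x <= b -> `|f x| <= M) ->
  `|\int[mu]_(x in `[a, b]) f x| <= M * (b - a).
Proof.
move=> ab cf fM.
have cnf : {within `[a, b], continuous (fun x => `|f x|)}.
  by move=> x; apply: continuous_comp; [exact: cf | exact: norm_continuous].
apply: (le_trans (le_normr_Rintegral _ _)) => //.
  exact: continuous_integrable_cc.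
apply: (@le_trans _ _ (\int[mu]_(x in `[a, b]) M)).
  apply: le_Rintegral => //; first exact: continuous_integrable_cc.
  - by apply: continuous_integrable_cc => x; exact: cst_continuous.
rewrite Rintegral_cst//= lebesgue_measure_itv /= lte_fin.
by case: ltgtP ab => [_ _|//|-> _] /=; rewrite ?subrr.
Qed.

Lemma Rintegral_expansion f F a b : a < b -> {within `[a, b], continuous f} ->
  (forall x, a <= x <= b -> expansion_in `[a, b] F x (f x)) ->
  \int[mu]_(x in `[a, b]) f x = F b - F a.
Proof.
move=> ab cf H.
have dF x : x \in `]a, b[ -> is_derive x 1 F (f x).
  rewrite in_itv /= => xab; apply: (@expansion_is_derive _ a b) => //.
  by apply: H; case/andP: xab => /ltW -> /ltW ->.
have cF : {within `[a, b], continuous F}.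
  by apply: expansion_in_continuous => x; rewrite /= in_itv /= => xab; exists (f x); exact: H.
have [_ cFa cFb] := (continuous_within_itvP F ab).1 cF.
rewrite /Rintegral (continuous_FTC2 ab cf (F := F)) //.
- by split=> // x /dF[].
- by move=> x /dF[? <-]; rewrite derive1E.
Qed.

End SegmentIntegral.

(** * Pairing with the adjoint heat equation *)

Section Duality.
Context {R : realType}.
Local Notation mu := (@lebesgue_measure R).

(** What the pairings use of a classical solution. The time expansion is uniform in [l], so that it
    can be integrated; [nh_xt] serves to bound the flux at a fixed point over a compact time
    interval. The trace at [l = 1] is left free, so that differences of solutions with different
    inputs qualify. *)
Record neumann_heat (gamma : R) (w wx wxx : R -> R -> R) : Prop := NeumannHeat {
  nh_x : forall t l, t <= 0 -> 0 <= l <= 1 ->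
    expansion_in `[0, 1] (w t) l (wx t l);
  nh_xx : forall t l, t <= 0 -> 0 <= l <= 1 ->
    expansion_in `[0, 1] (wx t) l (wxx t l);
  nh_cont : forall t, t <= 0 -> {within `[0, 1], continuous (wxx t)};
  nh_t : forall t, t <= 0 -> forall e : R, 0 < e -> exists2 r : R, 0 < r &
    forall s l, s <= 0 -> `|s - t| < r -> 0 <= l <= 1 ->
      `|w s l - w t l - (s - t) * (wxx t l - gamma * w t l)| <= e * `|s - t|;
  nh_neumann : forall t, t <= 0 -> wx t 0 = 0;
  nh_xt : forall t l, t <= 0 -> 0 <= l <= 1 ->
    exists d, expansion_in `]-oo, 0] (fun s => wx s l) t d }.

(* [P] solves the adjoint equation [P_t = - P_ll] with the Neumann condition at
   [0]; the quadratic remainder in [t] is uniform in [l]. *)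
Record adjoint_heat (r : R) (P P1 P2 : R -> R -> R) : Prop := AdjointHeat {
  ah_x : forall t l, -1 <= t <= 0 -> 0 <= l <= r ->
    expansion_in `[0, r] (P t) l (P1 t l);
  ah_xx : forall t l, -1 <= t <= 0 -> 0 <= l <= r ->
    expansion_in `[0, r] (P1 t) l (P2 t l);
  ah_cont : forall t, -1 <= t <= 0 -> {within `[0, r], continuous (P2 t)};
  ah_t : exists L : R, forall s t l,
    -1 <= s <= 0 -> -1 <= t <= 0 -> 0 <= l <= r ->
      `|P s l - P t l + (s - t) * P2 t l| <= L * (s - t) ^+ 2;
  ah_neumann : forall t, -1 <= t <= 0 -> P1 t 0 = 0 }.

Lemma within_continuousW (f : R -> R) (r : R) : r <= 1 ->
  {within `[0, 1], continuous f} -> {within `[0, r], continuous f}.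
Proof.
move=> r1; apply: continuous_subspaceW => x /=.
by rewrite !in_itv /= => /andP[-> /le_trans ->].
Qed.

Lemma within_continuousM (I : set R) (f g : R -> R) : {within I, continuous f} ->
  {within I, continuous g} -> {within I, continuous (fun x => f x * g x)}.
Proof. by move=> cf cg x; apply: cvgM; [exact: cf|exact: cg]. Qed.

Lemma within_continuousB (I : set R) (f g : R -> R) : {within I, continuous f} ->
  {within I, continuous g} -> {within I, continuous (fun x => f x - g x)}.
Proof. by move=> cf cg x; apply: cvgB; [exact: cf|exact: cg]. Qed.

Lemma within_continuousD (I : set R) (f g : R -> R) : {within I, continuous f} ->
  {within I, continuous g} -> {within I, continuous (fun x => f x + g x)}.
Proof. by move=> cf cg x; apply: cvgD; [exact: cf|exact: cg]. Qed.

Lemma within_continuousZ (I : set R) (c : R) (f : R -> R) :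
  {within I, continuous f} -> {within I, continuous (fun x => c * f x)}.
Proof. by move=> cf x; apply: cvgMr; exact: cf. Qed.

Lemma within_continuous_norm (I : set R) (f : R -> R) :
  {within I, continuous f} -> {within I, continuous (fun x => `|f x|)}.
Proof. by move=> cf x; apply: continuous_comp; [exact: cf|exact: norm_continuous]. Qed.

Variables (gamma : R) (w wx wxx : R -> R -> R).
Hypothesis hw : neumann_heat gamma w wx wxx.

Lemma nh_cont_w t : t <= 0 -> {within `[0, 1], continuous (w t)}.
Proof.
move=> t0; apply: expansion_in_continuous => l; rewrite /= in_itv /= => l01.
by exists (wx t l); exact: (nh_x hw).
Qed.

Variables (r : R) (P P1 P2 : R -> R -> R).
Hypothesis (r0 : 0 < r) (r1 : r <= 1).
Hypothesis hP : adjoint_heat r P P1 P2.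

Lemma ah_cont_P t : -1 <= t <= 0 -> {within `[0, r], continuous (P t)}.
Proof.
move=> t0; apply: expansion_in_continuous => l; rewrite /= in_itv /= => l01.
by exists (P1 t l); exact: (ah_x hP).
Qed.

(** The function [wx * P - w * P1] is a primitive of the integrand, and it vanishes at [0] by the
    two Neumann conditions. *)
Lemma green_identity t : -1 <= t <= 0 ->
  \int[mu]_(l in `[0, r]) (wxx t l * P t l - w t l * P2 t l) =
  wx t r * P t r - w t r * P1 t r.
Proof.
move=> t01; have t0 : t <= 0 by case/andP: t01.
have cw := within_continuousW r1 (nh_cont_w t0).
have cwxx := within_continuousW r1 (nh_cont hw t0).
rewrite (@Rintegral_expansion _ _ (fun l => wx t l * P t l - w t l * P1 t l)) //.
- by rewrite (nh_neumann hw t0) (ah_neumann hP t01) mul0r mulr0 subr0 subr0.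
- apply: within_continuousB; apply: within_continuousM => //.
    exact: ah_cont_P.
  exact: (ah_cont hP).
- move=> l l0r; have l01 : 0 <= l <= 1.
    by case/andP: l0r => -> /le_trans ->.
  have sub s : s \in `[0, r] -> `|s - l| < 1 -> s \in `[0, 1].
    by rewrite !in_itv /= => /andP[-> /le_trans ->].
  have Ew := expansion_inW ltr01 sub (nh_x hw t0 l01).
  have Ewx := expansion_inW ltr01 sub (nh_xx hw t0 l01).
  have E1 := expansion_inM Ewx (ah_x hP t01 l0r).
  have E2 := expansion_inM Ew (ah_xx hP t01 l0r).
  have := expansion_inB E1 E2.
  by congr (expansion_in _ _ _ _); ring.
Qed.

Lemma expansion_pairing t : -1 <= t <= 0 ->
  expansion_in `[-1, 0] (fun s => \int[mu]_(l in `[0, r]) (w s l * P s l)) t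
   (wx t r * P t r - w t r * P1 t r
    - gamma * \int[mu]_(l in `[0, r]) (w t l * P t l)).
Proof.
move=> t01; have t0 : t <= 0 by case/andP: t01.
have cw s : s <= 0 -> {within `[0, r], continuous (w s)}.
  by move=> s0; exact: within_continuousW (nh_cont_w s0).
have cwxx := within_continuousW r1 (nh_cont hw t0).
have cP := ah_cont_P.
have cP2 := ah_cont hP.
have cwP s : -1 <= s <= 0 -> {within `[0, r], continuous (fun l => w s l * P s l)}.
  by move=> /[dup] s01 /andP[_ s0]; apply: within_continuousM; [exact: cw|exact: cP].
have cD : {within `[0, r], continuous (fun l => wxx t l * P t l - w t l * P2 t l)}.
  apply: within_continuousB; apply: within_continuousM => //.
  - exact: cP.
  - exact: cw.
  - exact: cP2.
rewrite -green_identity// -RintegralZl//; last by apply: continuous_integrable_cc; exact: cwP.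
rewrite -RintegralB//; last 2 first.
- exact: continuous_integrable_cc.
- by apply: continuous_integrable_cc; apply: within_continuousZ; exact: cwP.
have cwd : {within `[0, r], continuous (fun l => wxx t l - gamma * w t l)}.
  by apply: within_continuousB => //; apply: within_continuousZ; exact: cw.
have [Md Md0 HMd] := within_continuous_bounded (ltW r0) cwd.
have [Mw Mw0 HMw] := within_continuous_bounded (ltW r0) (cw t t0).
have [Mp Mp0 HMp] := within_continuous_bounded (ltW r0) (cP t t01).
have [M2 M20 HM2] := within_continuous_bounded (ltW r0) (cP2 t t01).
have [L0 HL0] := ah_t hP.
pose L := `|L0| + 1.
have L0' : 0 < L by rewrite /L ltr_wpDl.
have HL s l : -1 <= s <= 0 -> 0 <= l <= r ->
    `|P s l - P t l + (s - t) * P2 t l| <= L * (s - t) ^+ 2.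
  move=> s01 l0r; apply: (le_trans (HL0 _ _ _ s01 t01 l0r)).
  by rewrite ler_wpM2r ?sqr_ge0// (le_trans (ler_norm _))// lerDl.
move=> e e0.
(* [A] bounds [P s] as long as [|s - t| < 1]; [B] collects the coefficients of [(s - t)^2]. *)
pose A := Mp + L + M2; pose B := Md * (L + M2) + Mw * L.
have A0 : 0 < A by apply: addr_gt0 => //; exact: addr_gt0.
have B0 : 0 < B by apply: addr_gt0; apply: mulr_gt0 => //; exact: addr_gt0.
have e20 : 0 < e / 2 by rewrite divr_gt0.
have [rh rh0 Hrh] := nh_t hw t0 (divr_gt0 e20 A0).
exists (Num.min (Num.min rh 1) (e / 2 / B)).
  by rewrite !lt_min rh0 ltr01 divr_gt0.
move=> s; rewrite /= in_itv /= => s01; rewrite !lt_min => /andP[/andP[srh sr1] srB].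
have s0 : s <= 0 by case/andP: s01.
rewrite -RintegralB//; last 2 first.
- by apply: continuous_integrable_cc; exact: cwP.
- by apply: continuous_integrable_cc; exact: cwP.
rewrite [X in _ - X](_ : _ = \int[mu]_(l in `[0, r])
   ((s - t) * (wxx t l * P t l - w t l * P2 t l - gamma * (w t l * P t l)))); last first.
  rewrite RintegralZl//; apply: continuous_integrable_cc.
  by apply: within_continuousB => //; apply: within_continuousZ; exact: cwP.
rewrite -RintegralB//; last 2 first.
- by apply: continuous_integrable_cc; apply: within_continuousB; exact: cwP.
- apply: continuous_integrable_cc; apply: within_continuousZ.
  by apply: within_continuousB => //; apply: within_continuousZ; exact: cwP.
apply: (@le_trans _ _ (e * `|s - t| * (r - 0))); last first.
  by rewrite subr0 ler_piMr// mulr_ge0// ltW.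
apply: le_Rintegral_cc; first exact: ltW.
  apply: within_continuousB; first by apply: within_continuousB; exact: cwP.
  apply: within_continuousZ.
  by apply: within_continuousB => //; apply: within_continuousZ; exact: cwP.
move=> l l0r; have l01 : 0 <= l <= 1 by case/andP: l0r => -> /le_trans ->.
(* The error of [w] times [P s], plus a product of two first-order increments, plus [w t] times the
   error of [P]. The last two are quadratic in [s - t]. *)
have -> : w s l * P s l - w t l * P t l -
    (s - t) * (wxx t l * P t l - w t l * P2 t l - gamma * (w t l * P t l)) =
  (w s l - w t l - (s - t) * (wxx t l - gamma * w t l)) * P s l +
  ((wxx t l - gamma * w t l) * ((s - t) * (P s l - P t l)) +
   w t l * (P s l - P t l + (s - t) * P2 t l)) by ring.
have h0 := normr_ge0 (s - t).
have h2 : (s - t) ^+ 2 = `|s - t| * `|s - t| by rewrite -expr2 -normrX ger0_norm// sqr_ge0.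
have dP : `|P s l - P t l| <= `|s - t| * (L + M2).
  rewrite -(addrK ((s - t) * P2 t l) (P s l - P t l)) (le_trans (ler_normB _ _))//.
  rewrite mulrDr lerD//; last by rewrite normrM ler_wpM2l// HM2.
  apply: (le_trans (HL s l s01 l0r)).
  by rewrite h2 mulrC -mulrA ler_wpM2l// ler_piMl ?ltW.
have Ps : `|P s l| <= A.
  rewrite -(subrK (P t l) (P s l)) (le_trans (ler_normD _ _))// addrC /A -addrA.
  rewrite lerD ?HMp// (le_trans dP)// ler_piMl ?ltW// addr_gt0//.
have -> : e * `|s - t| = e / 2 * `|s - t| + e / 2 * `|s - t| by field.
apply: (le_trans (ler_normD _ _)); apply: lerD.
  rewrite normrM; apply: (le_trans (ler_pM _ _ (Hrh _ _ s0 srh l01) Ps)) => //.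
  by rewrite mulrAC divfK// gt_eqF.
apply: (@le_trans _ _ (B * `|s - t| * `|s - t|)); last first.
  by rewrite ler_wpM2r// mulrC -ler_pdivlMr// ltW.
rewrite /B; apply: (le_trans (ler_normD _ _)).
have -> : (Md * (L + M2) + Mw * L) * `|s - t| * `|s - t| =
  Md * (`|s - t| * (`|s - t| * (L + M2))) + Mw * (L * (`|s - t| * `|s - t|)) by ring.
apply: lerD; rewrite normrM; apply: ler_pM; rewrite ?HMd ?HMw -?h2 ?HL//.
by rewrite normrM ler_wpM2l.
Qed.

Definition weighted_pairing t := expR (gamma * t) * \int[mu]_(l in `[0, r]) (w t l * P t l).

Lemma expansion_weighted_pairing t : -1 <= t <= 0 ->
  expansion_in `[-1, 0] weighted_pairing t
    (expR (gamma * t) * (wx t r * P t r - w t r * P1 t r)).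
Proof.
move=> t01.
have := expansion_inM (expansion_expR `[-1, 0] gamma t) (expansion_pairing t01).
by congr (expansion_in _ _ _ _); ring.
Qed.

End Duality.

(** * Derivatives of the heat kernel *)

Section GaussianDerivatives.
Context {R : realType}.
Local Notation mu := (@lebesgue_measure R).

(* The [j]-th derivative of [exp (- z^2 / 4)] is [hermite j * exp (- z^2 / 4)]. *)
Fixpoint hermite (j : nat) : {poly R} :=
  if j is i.+1 then (hermite i)^`() - 2^-1%:P * ('X * hermite i) else 1.

Definition gauss (j : nat) (z : R) : R := (hermite j).[z] * expR (- (z ^+ 2 / 4)).

Lemma hermiteS j : hermite j.+1 = (hermite j)^`() - 2^-1%:P * ('X * hermite j).
Proof. by []. Qed.

Lemma hermite_deriv j : (hermite j.+1)^`() = - (2^-1%:P * hermite j *+ j.+1).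
Proof.
elim: j => [|j IH].
  by rewrite /= derivC sub0r mulr1 derivN derivM derivC derivX mul0r add0r mulr1.
rewrite [hermite j.+2]/= -/(hermite j.+1) derivB IH derivN derivMn !derivM derivC derivX.
rewrite IH [hermite j.+1]/=.
by move: (hermite j)^`() (hermite j) 'X (2^-1%:P) => u v x h; ring.
Qed.

(** The heat equation written for self-similar profiles: it turns the time derivative of the kernel
    into two space derivatives. *)
Lemma gauss_rec j z : gauss j.+2 z = - 2^-1 * (j.+1%:R * gauss j z + z * gauss j.+1 z).
Proof.
rewrite /gauss hermiteS hermite_deriv hornerD !hornerN hornerMn !hornerM hornerX hornerC.
by rewrite -[_ *+ j.+1]mulr_natl; ring.
Qed.

Lemma gauss_odd0 k : gauss k.*2.+1 0 = 0.
Proof.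
elim: k => [|k IH]; first last.
  by rewrite doubleS gauss_rec IH; ring.
rewrite /gauss hermiteS hornerD hornerN !hornerM hornerX mul0r mulr0 subr0.
by rewrite derivC horner0 mul0r.
Qed.

Lemma expansion_gauss I j z : expansion_in I (gauss j) z (gauss j.+1 z).
Proof.
have E2 : expansion_in I (fun z : R => expR (- (z ^+ 2 / 4))) z
    (expR (- (z ^+ 2 / 4)) * (- 4^-1 * (1 * z + z * 1))).
  apply: (@expansion_in_comp R I expR (fun z : R => - (z ^+ 2 / 4))).
    by apply: is_derive_expansion_in; exact: is_derive_expR.
  have := expansion_inZ (- 4^-1) (expansion_inM (expansion_id I z) (expansion_id I z)).
  by congr (expansion_in _ _ _ _); apply/funext => x; field.
have E1 : expansion_in I (horner (hermite j)) z (hermite j)^`().[z].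
  by apply: is_derive_expansion_in; exact: is_derive_poly.
have := expansion_inM E1 E2.
congr (expansion_in _ _ _ _).
by rewrite /gauss hermiteS hornerD hornerN !hornerM hornerX hornerC; field.
Qed.

(** Induction along the Horner form: half of the rate [a] bounds the shorter polynomial, the other
    half bounds the additional factor [z]. *)
Lemma poly_le_expR (p : {poly R}) (a : R) : 0 < a ->
  exists2 B : R, 0 < B & forall z, `|p.[z]| <= B * expR (a * `|z|).
Proof.
elim/poly_ind: p a => [|p c IH] a a0.
  by exists 1 => // z; rewrite horner0 normr0 mul1r expR_ge0.
have a20 : 0 < a / 2 by rewrite divr_gt0.
have [B B0 HB] := IH _ a20.
have c1 : 0 < `|c| + 1 by rewrite ltr_wpDl.
exists (B * (2 / a) + (`|c| + 1)); first by rewrite addr_gt0// mulr_gt0// divr_gt0.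
move=> z; rewrite hornerMXaddC (le_trans (ler_normD _ _))// mulrDl lerD//.
  rewrite normrM; have -> : a * `|z| = a / 2 * `|z| + a / 2 * `|z| by field.
  rewrite expRD.
  have -> : B * (2 / a) * (expR (a / 2 * `|z|) * expR (a / 2 * `|z|)) =
    (B * expR (a / 2 * `|z|)) * (2 / a * expR (a / 2 * `|z|)) by ring.
  apply: ler_pM => //; rewrite -ler_pdivrMl ?divr_gt0// invf_div.
  by apply: le_trans (expR_ge1Dx _); rewrite lerDr.
apply: (@le_trans _ _ ((`|c| + 1) * 1)); first by rewrite mulr1 lerDl.
apply: ler_wpM2l; first exact: ltW.
apply: le_trans (expR_ge1Dx _).
by rewrite lerDl mulr_ge0// ltW.
Qed.

(** Exponential decay is weaker than what holds, but [exp (- z)] has an explicit primitive, which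
    the remainder estimate integrates. *)
Lemma poly_gauss_bound (p : {poly R}) :
  exists2 B : R, 0 < B & forall z,
    `|p.[z]| * expR (- (z ^+ 2 / 4)) <= B * expR (- `|z|).
Proof.
have [B B0 HB] := poly_le_expR p ltr01.
(* The constant comes from [2 x - x^2 / 4 <= 4]: one [x] pays for the polynomial, the other is the
   decay that remains. *)
exists (B * expR 4); first by rewrite mulr_gt0// expR_gt0.
move=> z; apply: (@le_trans _ _ (B * expR (1 * `|z|) * expR (- (z ^+ 2 / 4)))).
  by rewrite ler_wpM2r// expR_ge0.
rewrite -[leLHS]mulrA -[leRHS]mulrA -!expRD ler_wpM2l ?(ltW B0)// ler_expR.
have -> : z ^+ 2 = `|z| ^+ 2 by rewrite real_normK ?num_real.
have := sqr_ge0 (`|z| / 2 - 2); move: `|z| => x; rewrite !expr2; lra.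
Qed.

Lemma gauss_bound j (m : nat) : exists2 B : R, 0 < B & forall z,
  `|z ^+ m * gauss j z| <= B * expR (- `|z|).
Proof.
have [B B0 HB] := poly_gauss_bound ('X^m * hermite j); exists B => // z.
have := HB z; rewrite hornerM hornerXn => Hz.
by rewrite /gauss mulrA normrM [`|expR _|]ger0_norm ?expR_ge0.
Qed.

Lemma gauss_bounded j (m : nat) : exists2 B : R, 0 < B & forall z, `|z ^+ m * gauss j z| <= B.
Proof.
have [B B0 HB] := gauss_bound j m; exists B => // z; apply: (le_trans (HB z)).
by rewrite ler_piMr ?(ltW B0)// -expR0 ler_expR oppr_le0.
Qed.

(* The [j]-th space derivative of [s * exp (- (s l)^2 / 4)], which is the heat
   kernel at time [s^-2] up to a constant factor. *)
Definition kernel_deriv (j : nat) (s l : R) : R := s ^+ j.+1 * gauss j (s * l).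

Lemma expansion_kernel_l I j s l :
  expansion_in I (kernel_deriv j s) l (kernel_deriv j.+1 s l).
Proof.
have -> : kernel_deriv j.+1 s l = s ^+ j.+1 * (s * gauss j.+1 (s * l)).
  by rewrite /kernel_deriv exprSr mulrA.
by apply: expansion_inZ; apply: expansion_scaled; exact: expansion_gauss.
Qed.

Lemma kernel_continuous j s : continuous (kernel_deriv j s).
Proof.
move=> l.
have /is_derive_expansion [+ _] := @expansion_kernel_l setT j s l.
by move=> /derivable1_diffP /differentiable_continuous.
Qed.

Lemma expansion_kernel_s I j s l : expansion_in I (kernel_deriv j ^~ l) s
  (j.+1%:R * s ^+ j * gauss j (s * l) + s ^+ j.+1 * (l * gauss j.+1 (s * l))).
Proof.
apply: expansion_inM; first exact: expansion_exprn.
have := @expansion_scaled R I (gauss j) l s (gauss j.+1 (l * s)).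
rewrite [l * s]mulrC => /(_ (expansion_gauss _ _ _)).
by congr (expansion_in _ _ _ _); apply/funext => x; rewrite mulrC.
Qed.

Definition inv_sqrt (x : R) : R := (Num.sqrt x)^-1.

Lemma expansion_inv_sqrt I (x : R) : 0 < x ->
  expansion_in I inv_sqrt x (- 2^-1 * inv_sqrt x ^+ 3).
Proof.
move=> x0; apply: is_derive_expansion_in.
have sx0 : Num.sqrt x != 0 by rewrite gt_eqF// sqrtr_gt0.
have H := is_derive1_sqrt x0.
have := is_deriveV sx0 H.
congr (is_derive _ _ _ _); rewrite /inv_sqrt /GRing.scale /=.
by field.
Qed.

(** For [s = (eps - t)^(-1/2)] one has [ds/dt = s^3 / 2]; the chain rule and [gauss_rec] then give
    the backward heat equation. *)
Lemma expansion_kernel_time I j (eps t l : R) : t < eps ->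
  expansion_in I (fun t => kernel_deriv j (inv_sqrt (eps - t)) l) t
    (- kernel_deriv j.+2 (inv_sqrt (eps - t)) l).
Proof.
move=> te; have x0 : 0 < eps - t by rewrite subr_gt0.
have E0 : expansion_in I (fun t => eps - t) t (0 - 1).
  by apply: expansion_inB; [exact: expansion_cst|exact: expansion_id].
have E1 := @expansion_in_comp R I inv_sqrt (fun t => eps - t) _ _ _
  (expansion_inv_sqrt setT x0) E0.
have := @expansion_in_comp R I (kernel_deriv j ^~ l) (fun t => inv_sqrt (eps - t))
  _ _ _ (@expansion_kernel_s setT j _ l) E1.
congr (expansion_in _ _ _ _); move: (inv_sqrt _) => s.
by rewrite /kernel_deriv gauss_rec !exprS; field.
Qed.

End GaussianDerivatives.

(** * Odd Taylor coefficients of a Neumann state *)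

Section Taylor.
Context {R : realType}.

Lemma expansion_MVT_segment (f df : R -> R) (a b s t : R) :
  (forall x, a <= x <= b -> expansion_in `[a, b] f x (df x)) ->
  a <= s <= b -> a <= t <= b ->
  exists2 c, a <= c <= b /\ `|c - t| <= `|s - t| & f s - f t = df c * (s - t).
Proof.
move=> H /andP[as_ sb] /andP[at_ tb].
have aux u v : a <= u -> v <= b -> u < v ->
    exists2 c, u < c < v & f v - f u = df c * (v - u).
  move=> au vb uv; apply: expansion_MVT => // x /andP[ux xv].
  have xab : a <= x <= b by rewrite (le_trans au ux) (le_trans xv vb).
  apply: expansion_inW ltr01 _ (H x xab) => y.
  by rewrite /= !in_itv /= => /andP[uy yv] _; rewrite (le_trans au uy) (le_trans yv vb).
have [st|ts|->] := ltgtP s t; last first.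
- by exists t; rewrite ?subrr ?mulr0// at_ tb.
- have [c /andP[c1 c2] E] := aux _ _ at_ sb ts; exists c => //; split.
    by rewrite (le_trans at_ (ltW c1)) (le_trans (ltW c2) sb).
  by rewrite !ger0_norm ?subr_ge0 ?(ltW ts) ?(ltW c1)// lerD2r ltW.
- have [c /andP[c1 c2] E] := aux _ _ as_ tb st.
  exists c; last by rewrite -opprB E -mulrN opprB.
  split; first by rewrite (le_trans as_ (ltW c1)) (le_trans (ltW c2) tb).
  by rewrite !ler0_norm ?subr_le0 ?(ltW st) ?(ltW c2)// !opprB lerD2l lerN2 ltW.
Qed.

(** The mean value theorem applied twice, hence [L] in place of the sharp [L / 2]. It supplies the
    quadratic remainder in [adjoint_heat]. *)
Lemma taylor2 (f f1 f2 : R -> R) (a b L s t : R) :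
  (forall x, a <= x <= b -> expansion_in `[a, b] f x (f1 x)) ->
  (forall x, a <= x <= b -> expansion_in `[a, b] f1 x (f2 x)) ->
  (forall x, a <= x <= b -> `|f2 x| <= L) ->
  a <= s <= b -> a <= t <= b ->
  `|f s - f t - (s - t) * f1 t| <= L * (s - t) ^+ 2.
Proof.
move=> H1 H2 HL sab tab.
have [c [cab ct] ->] := expansion_MVT_segment H1 sab tab.
have [c' [c'ab _] E] := expansion_MVT_segment H2 cab tab.
have -> : f1 c * (s - t) - (s - t) * f1 t = (f1 c - f1 t) * (s - t) by ring.
rewrite E !normrM -mulrA; apply: ler_pM => //; first exact: HL.
have -> : (s - t) ^+ 2 = `|s - t| * `|s - t| by rewrite -expr2 -normrX ger0_norm// sqr_ge0.
by rewrite ler_wpM2r.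
Qed.

End Taylor.

(** * Moments of the kernel derivatives and the bounded pairing *)

Section NeumannRegularity.
Context {R : realType}.
Local Notation mu := (@lebesgue_measure R).

Lemma kernel_deriv_bound j : exists2 B : R, 0 < B &
  forall s l, 0 <= s -> `|kernel_deriv j s l| <= B * s ^+ j.+1.
Proof.
have [B B0 HB] := @gauss_bounded R j 0; exists B => // s l s0.
rewrite /kernel_deriv normrM mulrC [`|s ^+ _|]ger0_norm ?exprn_ge0// ler_wpM2r ?exprn_ge0//.
by have := HB (s * l); rewrite expr0 mul1r.
Qed.

(** The factor [s^(j+1)] equals [(s r)^(j+1) / r^(j+1)], and the power of [s r] is absorbed by the
    Gaussian. The bound is therefore uniform up to the singular time. *)
Lemma kernel_deriv_away j (r : R) : 0 < r -> exists2 B : R, 0 < B &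
  forall s, `|kernel_deriv j s r| <= B.
Proof.
move=> r0; have [B B0 HB] := @gauss_bounded R j j.+1.
exists (B / r ^+ j.+1) => [|s]; first by rewrite divr_gt0// exprn_gt0.
rewrite ler_pdivlMr ?exprn_gt0//; apply: le_trans (HB (s * r)).
rewrite -[X in _ * X <= _](ger0_norm (exprn_ge0 _ (ltW r0))) -normrM /kernel_deriv.
by have -> : s ^+ j.+1 * gauss j (s * r) * r ^+ j.+1 = (s * r) ^+ j.+1 * gauss j (s * r)
  by rewrite exprMn mulrAC.
Qed.

Lemma inv_sqrt_le (eps x : R) : 0 < eps -> eps <= x -> 0 <= inv_sqrt x <= inv_sqrt eps.
Proof.
move=> e0 ex; rewrite /inv_sqrt invr_ge0 sqrtr_ge0 /=.
by rewrite lef_pV2 ?posrE ?sqrtr_gt0 ?(lt_le_trans e0)// ler_sqrt// (le_trans (ltW e0)).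
Qed.

(** The order is even so that [P1] is an odd derivative of an even function and vanishes at the
    origin. *)
Lemma kernel_adjoint (k : nat) (eps r : R) : 0 < eps -> 0 < r ->
  adjoint_heat r (fun t => kernel_deriv k.*2 (inv_sqrt (eps - t)))
    (fun t => kernel_deriv k.*2.+1 (inv_sqrt (eps - t)))
    (fun t => kernel_deriv k.*2.+2 (inv_sqrt (eps - t))).
Proof.
move=> e0 r0.
have te t : -1 <= t <= 0 -> t < eps by move=> /andP[_] /le_lt_trans; apply.
split.
- by move=> t l _ _; exact: expansion_kernel_l.
- by move=> t l _ _; exact: expansion_kernel_l.
- by move=> t _; apply: continuous_subspaceT; exact: kernel_continuous.
(* Two time derivatives amount to four space derivatives, and for [t <= 0] the scale is at most
   [inv_sqrt eps]. *)
- have [B B0 HB] := kernel_deriv_bound k.*2.+4.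
  exists (B * inv_sqrt eps ^+ k.*2.+4.+1) => s t l s01 t01 l0r.
  have H x : -1 <= x <= 0 ->
      `|kernel_deriv k.*2.+4 (inv_sqrt (eps - x)) l| <= B * inv_sqrt eps ^+ k.*2.+4.+1.
    move=> /andP[_ x0]; have ex : eps <= eps - x by rewrite lerDl oppr_ge0.
    have /andP[i0 ie] := inv_sqrt_le e0 ex.
    apply: (le_trans (HB _ l i0)); rewrite ler_wpM2l ?(ltW B0)//.
    by rewrite lerXn2r ?nnegrE// (le_trans i0).
  have := @taylor2 R (fun t => kernel_deriv k.*2 (inv_sqrt (eps - t)) l)
   (fun t => - kernel_deriv k.*2.+2 (inv_sqrt (eps - t)) l)
   (fun t => kernel_deriv k.*2.+4 (inv_sqrt (eps - t)) l) (-1) 0 _ s t _ _ H s01 t01.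
  rewrite mulrN opprK; apply.
  + by move=> x /te xe; exact: expansion_kernel_time.
  + move=> x /te xe; rewrite -[X in expansion_in _ _ _ X]opprK.
    by apply: expansion_inN; exact: expansion_kernel_time.
- by move=> t _; rewrite /kernel_deriv mulr0 gauss_odd0 mulr0.
Qed.

Lemma kernel_moment_cont (i j : nat) (s r : R) :
  {within `[0, r], continuous (fun l => l ^+ i * kernel_deriv j s l)}.
Proof.
apply: continuous_subspaceT => l; apply: cvgM; last exact: kernel_continuous.
exact: exprn_continuous.
Qed.

(** Integration by parts lowers the power and the order together; their difference, which decides
    the growth in [s], is preserved. *)
Lemma kernel_moment_step (i j : nat) (s r : R) : 0 < r ->
  \int[mu]_(l in `[0, r]) (l ^+ i.+1 * kernel_deriv j.+1 s l) =
  r ^+ i.+1 * kernel_deriv j s r -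
  i.+1%:R * \int[mu]_(l in `[0, r]) (l ^+ i * kernel_deriv j s l).
Proof.
move=> r0.
have cK := kernel_moment_cont.
have cF : {within `[0, r], continuous (fun l =>
    i.+1%:R * (l ^+ i * kernel_deriv j s l) + l ^+ i.+1 * kernel_deriv j.+1 s l)}.
  by apply: within_continuousD; [apply: within_continuousZ|]; exact: cK.
have /(Rintegral_expansion r0 cF) : forall l, 0 <= l <= r ->
    expansion_in `[0, r] (fun l => l ^+ i.+1 * kernel_deriv j s l) l
    (i.+1%:R * (l ^+ i * kernel_deriv j s l) + l ^+ i.+1 * kernel_deriv j.+1 s l).
  move=> l _; rewrite mulrA; apply: expansion_inM; first exact: expansion_exprn.
  exact: expansion_kernel_l.
rewrite RintegralD//; last 2 first.
- by apply: continuous_integrable_cc; apply: within_continuousZ; exact: cK.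
- by apply: continuous_integrable_cc; exact: cK.
rewrite RintegralZl//; last by apply: continuous_integrable_cc; exact: cK.
by rewrite expr0n /= mul0r subr0 => <-; rewrite [RHS]addrC addKr.
Qed.

Lemma kernel_moment0 (j : nat) (s r : R) : 0 < r ->
  \int[mu]_(l in `[0, r]) (l ^+ 0 * kernel_deriv j.+1 s l) =
  kernel_deriv j s r - kernel_deriv j s 0.
Proof.
move=> r0; apply: Rintegral_expansion => //; first exact: kernel_moment_cont.
by move=> l _; rewrite expr0 mul1r; exact: expansion_kernel_l.
Qed.

(** The integrations by parts end at the kernel derivative of order one, which is zero at the
    origin; all other boundary terms sit at [r], where the kernel is bounded. *)
Lemma kernel_moment_even (i : nat) (r : R) : 0 < r -> exists M : R, forall s,
  `|\int[mu]_(l in `[0, r]) (l ^+ i * kernel_deriv i.+2 s l)| <= M.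
Proof.
move=> r0; elim: i => [|i [M HM]].
  have [B B0 HB] := kernel_deriv_away 1 r0; exists B => s.
  rewrite kernel_moment0// [X in _ - X](_ : _ = 0) ?subr0//.
  by rewrite /kernel_deriv mulr0 (gauss_odd0 0 : gauss 1 0 = 0) mulr0.
have [B B0 HB] := kernel_deriv_away i.+2 r0.
exists (r ^+ i.+1 * B + i.+1%:R * M) => s.
rewrite kernel_moment_step//; apply: normrB_le; apply: normrM_le => //.
  by rewrite ger0_norm// exprn_ge0 ?(ltW r0).
by rewrite ger0_norm.
Qed.

(** Here they end at the kernel itself, whose value [s] at the origin is the only unbounded term. *)
Lemma kernel_moment_odd (i : nat) (r : R) : 0 < r -> exists M : R, forall s,
  `|\int[mu]_(l in `[0, r]) (l ^+ i * kernel_deriv i.+1 s l) + (-1) ^+ i * i`!%:R * s| <= M.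
Proof.
move=> r0; elim: i => [|i [M HM]].
  have [B B0 HB] := kernel_deriv_away 0 r0; exists B => s.
  rewrite kernel_moment0// [X in _ - X + _](_ : _ = s).
    by rewrite fact0 expr0 !mul1r subrK.
  by rewrite /kernel_deriv mulr0 /gauss /= -polyC1 hornerC mul1r expr0n /= mul0r oppr0 expR0 mulr1 expr1.
have [B B0 HB] := kernel_deriv_away i.+1 r0.
exists (r ^+ i.+1 * B + i.+1%:R * M) => s.
rewrite kernel_moment_step//.
have := HM s; set J := \int[mu]_(l in _) _ => HMs.
have -> : r ^+ i.+1 * kernel_deriv i.+1 s r - i.+1%:R * J + (-1) ^+ i.+1 * (i.+1)`!%:R * s =
    r ^+ i.+1 * kernel_deriv i.+1 s r - i.+1%:R * (J + (-1) ^+ i * i`!%:R * s).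
  by rewrite [(-1) ^+ i.+1]exprS factS natrM; ring.
apply: normrB_le; apply: normrM_le => //.
  by rewrite ger0_norm// exprn_ge0 ?(ltW r0).
by rewrite ger0_norm.
Qed.

(* The remainder is [O(l^j)], which the [j]-th derivative of the kernel
   integrates to a bounded quantity, by scaling. *)
Lemma kernel_remainder (j : nat) : exists2 B : R, 0 < B & forall (rho : R -> R) (C r s : R),
  0 < r -> 0 < s -> 0 <= C -> {within `[0, r], continuous rho} ->
  (forall l, 0 <= l <= r -> `|rho l| <= C * l ^+ j) ->
  `|\int[mu]_(l in `[0, r]) (rho l * kernel_deriv j s l)| <= C * B.
Proof.
have [B B0 HB] := @gauss_bound R j j; exists B => // rho C r s r0 s0 C0 crho Hrho.
have cK : {within `[0, r], continuous (fun l => rho l * kernel_deriv j s l)}.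
  apply: within_continuousM => //.
  by apply: continuous_subspaceT; exact: kernel_continuous.
(* The integrand will be dominated by [C * B * s * exp (- s l)], whose integral over [[0, r]] is at
   most [C * B] for every [s > 0]. *)
have E I l : expansion_in I (fun l => - (C * B) * expR (- s * l)) l
    (C * B * (s * expR (- s * l))).
  have := expansion_inZ (- (C * B)) (expansion_expR I (- s) l).
  by congr (expansion_in _ _ _ _); ring.
have cE : {within `[0, r], continuous (fun l => C * B * (s * expR (- s * l)))}.
  apply: within_continuousZ; apply: within_continuousZ.
  by apply: expansion_in_continuous => l _; exists (- s * expR (- s * l)); exact: expansion_expR.
apply: (le_trans (le_normr_Rintegral _ _)) => //; first exact: continuous_integrable_cc.
apply: (@le_trans _ _ (\int[mu]_(l in `[0, r]) (C * B * (s * expR (- s * l))))).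
  apply: le_Rintegral => //.
  - by apply: continuous_integrable_cc; exact: within_continuous_norm.
  - exact: continuous_integrable_cc.
  - move=> l; rewrite /= in_itv /= => /[dup] l0r /andP[l0 _].
    rewrite /kernel_deriv normrM.
    apply: (@le_trans _ _ (C * l ^+ j * `|s ^+ j.+1 * gauss j (s * l)|)).
      by rewrite ler_wpM2r// Hrho.
    have -> : C * l ^+ j * `|s ^+ j.+1 * gauss j (s * l)| =
        C * (s * `|(s * l) ^+ j * gauss j (s * l)|).
      rewrite -[in LHS](ger0_norm (exprn_ge0 j l0)) -mulrA -normrM.
      rewrite -[X in C * (X * _)](gtr0_norm s0) -normrM; congr (C * `|_|).
      by rewrite exprMn exprS; ring.
    rewrite -[leRHS]mulrA; apply: ler_wpM2l => //; rewrite [leRHS]mulrCA.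
    apply: ler_wpM2l; first exact: ltW.
    by apply: (le_trans (HB _)); rewrite normrM (ger0_norm l0) (gtr0_norm s0) mulNr.
rewrite (Rintegral_expansion r0 cE (fun l _ => E _ l)).
rewrite !mulNr opprK mulr0 oppr0 expR0 mulr1 addrC -[X in X - _]mulr1 -mulrBr.
by rewrite ler_piMr ?mulr_ge0 ?(ltW B0)// gerBl expR_ge0.
Qed.

Variables (gamma : R) (w wx wxx : R -> R -> R).
Hypothesis hw : neumann_heat gamma w wx wxx.

Lemma nh_bounds (r : R) : 0 <= r <= 1 -> exists2 M : R, 0 < M &
  forall t, -1 <= t <= 0 -> `|w t r| <= M /\ `|wx t r| <= M.
Proof.
move=> r01.
have cw : {within `[-1, 0], continuous (w ^~ r)}.
  apply: expansion_in_continuous => t; rewrite /= in_itv /= => /andP[_ t0].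
  exists (wxx t r - gamma * w t r) => e e0; have [d d0 Hd] := nh_t hw t0 e0.
  by exists d => // s; rewrite /= in_itv /= => /andP[_ s0] sd; exact: Hd.
have cwx : {within `[-1, 0], continuous (wx ^~ r)}.
  apply: expansion_in_continuous => t; rewrite /= in_itv /= => /andP[_ t0].
  have [d Hd] := nh_xt hw t0 r01; exists d; apply: expansion_inW ltr01 _ Hd => s.
  by rewrite /= !in_itv /= => /andP[].
have m10 : (-1 : R) <= 0 by rewrite lerN10.
have [M M0 HM] := within_continuous_bounded m10 cw.
have [M' M'0 HM'] := within_continuous_bounded m10 cwx.
exists (M + M'); first exact: addr_gt0.
move=> t t01; split.
  by apply: (le_trans (HM t t01)); rewrite lerDl ltW.
by apply: (le_trans (HM' t t01)); rewrite lerDr ltW.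
Qed.

Lemma odd_coefficient_eq0 (k : nat) (r b b' C : R) : 0 < r -> r <= 1 ->
  (forall l, 0 <= l <= r ->
     `|w 0 l + b * l ^+ k.*2 - b' * l ^+ k.*2.+1| <= C * l ^+ k.*2.+2) ->
  b' = 0.
Proof.
move=> r0 r1 Hw0; pose j := k.*2.+2.
have r01 : 0 <= r <= 1 by rewrite ltW.
have cw t : t <= 0 -> {within `[0, r], continuous (w t)}.
  by move=> t0; exact: within_continuousW (nh_cont_w hw t0).
(* Transport from [t = -1] to [t = 0]: at [t = -1] the kernel has scale at most [1], and the
   boundary terms at [r] are bounded uniformly in [s]. With [eps = s^-2] the scale at [t = 0] is
   exactly [s]. *)
have [M HM] : exists M : R, forall s, 1 <= s ->
    `|\int[mu]_(l in `[0, r]) (w 0 l * kernel_deriv j s l)| <= M.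
  have [Mw Mw0 HMw] := nh_bounds r01.
  have [M0 M00 HM0] := within_continuous_bounded (ltW r0) (cw (-1) (lerN10 R)).
  have [B B0 HB] := kernel_deriv_bound j.
  have [A A0 HA] := kernel_deriv_away j r0.
  have [A' A'0 HA'] := kernel_deriv_away j.+1 r0.
  have HE t : -1 <= t <= 0 -> `|expR (gamma * t)| <= expR `|gamma|.
    move=> /andP[t1 t0]; rewrite ger0_norm ?expR_ge0// ler_expR.
    rewrite (le_trans (ler_norm _))// normrM ler_piMr// ler_norml t1 (le_trans t0)//.
  exists (expR `|gamma| * (M0 * B) + expR `|gamma| * (Mw * A + Mw * A')) => s s1.
  have s0 : 0 < s by rewrite (lt_le_trans _ s1).
  pose eps := s ^- 2.
  have eps0 : 0 < eps by rewrite invr_gt0 exprn_gt0.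
  have hP := kernel_adjoint k.+1 eps0 r0.
  have epsE : inv_sqrt (eps - 0) = s.
    by rewrite subr0 /inv_sqrt /eps -exprVn sqrtr_sqr normfV invrK gtr0_norm.
  have HZ t := @expansion_weighted_pairing R gamma w wx wxx hw r _ _ _ r0 r1 hP t.
  have [c /andP[c1 c0]] := expansion_MVT (ltrN10 R) HZ.
  have c01 : -1 <= c <= 0 by rewrite !ltW.
  rewrite opprK add0r mulr1 => /eqP; rewrite subr_eq => /eqP.
  rewrite {1}/weighted_pairing mulr0 expR0 mul1r epsE doubleS -/j => ->.
  rewrite addrC (le_trans (ler_normD _ _))// lerD//; last first.
    have [h1 h2] := HMw c c01.
    by apply: normrM_le; [exact: HE|apply: normrB_le; exact: normrM_le].
  apply: normrM_le; first by apply: HE; rewrite lexx lerN10.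
  apply: (@le_trans _ _ (M0 * B * (r - 0))).
    apply: le_Rintegral_cc; first exact: ltW.
      apply: within_continuousM; first exact: cw.
      by apply: continuous_subspaceT; exact: kernel_continuous.
    move=> l l0r; apply: normrM_le; first exact: HM0.
    have e1 : 1 <= eps - -1 by rewrite opprK lerDr ltW.
    have /andP[i0 i1] := inv_sqrt_le ltr01 e1.
    apply: (le_trans (HB _ l i0)); rewrite ler_piMr ?(ltW B0)// exprn_ile1//.
    by rewrite (le_trans i1)// /inv_sqrt sqrtr1 invr1.
  by rewrite subr0 ler_piMr// mulr_ge0// ltW.
have [Me HMe] := kernel_moment_even k.*2 r0.
have [Mo HMo] := kernel_moment_odd k.*2.+1 r0.
have [B B0 HB] := kernel_remainder j.
apply/eqP; apply: contraT => b'0.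
pose C' := `|C|; pose rho l := w 0 l + b * l ^+ k.*2 - b' * l ^+ k.*2.+1.
have ck i : {within `[0, r], continuous (fun l : R => l ^+ i)}.
  by apply: continuous_subspaceT; exact: exprn_continuous.
have crho : {within `[0, r], continuous rho}.
  apply: within_continuousB; last by apply: within_continuousZ; exact: ck.
  by apply: within_continuousD; [exact: cw|apply: within_continuousZ; exact: ck].
have Hrho l : 0 <= l <= r -> `|rho l| <= C' * l ^+ j.
  move=> /[dup] /Hw0 H /andP[l0 _]; apply: (le_trans H).
  by rewrite ler_wpM2r ?exprn_ge0// ler_norm.
pose N : R := (k.*2.+1)`!%:R.
have N0 : 0 < N by rewrite ltr0n fact_gt0.
have b'p : 0 < `|b'| by rewrite normr_gt0.
(* In the expansion of [w 0] everything except the odd moment pairs to a bounded quantity, so the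
   linear growth of that moment must be bounded as well. *)
have bound s : 1 <= s -> `|b'| * N * s <= C' * B + M + `|b| * Me + `|b'| * Mo.
  move=> s1; have s0 : 0 < s by rewrite (lt_le_trans _ s1).
  have H1 := HB rho C' r s r0 s0 (normr_ge0 _) crho Hrho.
  have H2 := HM s s1; have H3 := HMe s; have H4 := HMo s.
  have cK i : {within `[0, r], continuous (fun l => l ^+ i * kernel_deriv j s l)}.
    exact: kernel_moment_cont.
  have cwK : {within `[0, r], continuous (fun l => w 0 l * kernel_deriv j s l)}.
    apply: within_continuousM; first exact: cw.
    by apply: continuous_subspaceT; exact: kernel_continuous.
  have E : \int[mu]_(l in `[0, r]) (rho l * kernel_deriv j s l) =
     \int[mu]_(l in `[0, r]) (w 0 l * kernel_deriv j s l)
     + b * \int[mu]_(l in `[0, r]) (l ^+ k.*2 * kernel_deriv j s l)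
     - b' * \int[mu]_(l in `[0, r]) (l ^+ k.*2.+1 * kernel_deriv j s l).
    rewrite -!RintegralZl//; try exact: continuous_integrable_cc.
    rewrite -RintegralD//; last 2 first.
    - exact: continuous_integrable_cc.
    - by apply: continuous_integrable_cc; exact: within_continuousZ.
    rewrite -RintegralB//; last 2 first.
    - apply: continuous_integrable_cc; apply: within_continuousD => //.
      exact: within_continuousZ.
    - by apply: continuous_integrable_cc; exact: within_continuousZ.
    by apply: eq_Rintegral => l _; rewrite /rho; ring.
  have sgn : (-1) ^+ k.*2.+1 = -1 :> R by rewrite exprS -mul2n exprM sqrrN !expr1n mulr1.
  rewrite E in H1; rewrite sgn mulN1r mulNr in H4; move: H1 H2 H3 H4.
  set I0 := \int[mu]_(l in _) (w 0 l * _); set J1 := \int[mu]_(l in _) _.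
  set J2 := \int[mu]_(l in _) _ => H1 H2 H3 H4.
  have -> : `|b'| * N * s = `|b' * N * s| by rewrite !normrM (gtr0_norm N0) (gtr0_norm s0).
  have -> : b' * N * s = - (I0 + b * J1 - b' * J2) + I0 + b * J1 - b' * (J2 - N * s) by ring.
  apply: (le_trans (ler_normB _ _)); apply: lerD; last exact: normrM_le.
  apply: (le_trans (ler_normD _ _)); apply: lerD; last exact: normrM_le.
  by apply: (le_trans (ler_normD _ _)); apply: lerD => //; rewrite normrN.
move: bound; set K := _ + _ => bound.
have b'N : 0 < `|b'| * N by exact: mulr_gt0.
(* At this value of [s] the left side equals [|b'| * N + |K| + 1], which exceeds [K]. *)
have := bound (1 + (`|K| + 1) / (`|b'| * N)).
rewrite lerDl divr_ge0 ?addr_ge0 ?(ltW b'N)// => /(_ isT).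
rewrite mulrDr mulr1 mulrCA divff ?gt_eqF// mulr1 => H.
have := ler_norm K; have := normr_ge0 K; lra.
Qed.

End NeumannRegularity.

(** * The boundary trace of a null state *)

Section BoundaryTrace.
Context {R : realType}.
Local Notation mu := (@lebesgue_measure R).

Definition half_odd_pi (k : nat) : R := k%:R * pi + pi / 2.

Lemma cos_half_odd_pi k : cos (half_odd_pi k) = 0.
Proof.
elim: k => [|k IH]; first by rewrite /half_odd_pi mul0r add0r cos_pihalf.
rewrite (_ : half_odd_pi k.+1 = half_odd_pi k + pi); first by rewrite cosDpi IH oppr0.
by rewrite /half_odd_pi -natr1; ring.
Qed.

Lemma half_odd_pi_ge k : k%:R + 1 <= half_odd_pi k.
Proof.
have p2 := @pi_ge2 R; rewrite /half_odd_pi lerD ?ler_pdivlMr ?mul1r//.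
by rewrite ler_peMr// (le_trans _ p2)// ler1n.
Qed.

Lemma cosine_adjoint (k : nat) : let m := half_odd_pi k in
  adjoint_heat 1 (fun t l => expR (m ^+ 2 * t) * cos (m * l))
    (fun t l => expR (m ^+ 2 * t) * (- m * sin (m * l)))
    (fun t l => expR (m ^+ 2 * t) * (- m ^+ 2 * cos (m * l))).
Proof.
move=> m.
have Ec (I : set R) l : expansion_in I (fun l => cos (m * l)) l (- m * sin (m * l)).
  have := @expansion_scaled R I (@cos R) m l _
    (is_derive_expansion_in setT (is_derive_cos (m * l))).
  by congr (expansion_in _ _ _ _); ring.
have Es (I : set R) l : expansion_in I (fun l => sin (m * l)) l (m * cos (m * l)).
  exact: (@expansion_scaled R I (@sin R) m l _
    (is_derive_expansion_in setT (is_derive_sin (m * l)))).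
split.
- by move=> t l _ _; apply: expansion_inZ; exact: Ec.
- move=> t l _ _; apply: expansion_inZ.
  by have := expansion_inZ (- m) (Es `[0, 1]%classic l); congr (expansion_in _ _ _ _); ring.
- move=> t _; apply: within_continuousZ; apply: within_continuousZ.
  by apply: expansion_in_continuous => l _; exists (- m * sin (m * l)); exact: Ec.
(* The second time derivative is [m^4] times the solution, which is at most one in absolute value
   for [t <= 0]. *)
- exists (m ^+ 4) => s t l s01 t01 l01.
  have Et (c x : R) : expansion_in `[-1, 0] (fun t => c * expR (m ^+ 2 * t)) x
      (m ^+ 2 * c * expR (m ^+ 2 * x)).
    have := expansion_inZ c (expansion_expR `[-1, 0] (m ^+ 2) x).
    by congr (expansion_in _ _ _ _); ring.
  have := @taylor2 R (fun t => cos (m * l) * expR (m ^+ 2 * t))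
    (fun t => m ^+ 2 * cos (m * l) * expR (m ^+ 2 * t))
    (fun t => m ^+ 2 * (m ^+ 2 * cos (m * l)) * expR (m ^+ 2 * t)) (-1) 0 (m ^+ 4) s t
    (fun x _ => Et _ x) (fun x _ => Et _ x) _ s01 t01.
  have -> : cos (m * l) * expR (m ^+ 2 * s) - cos (m * l) * expR (m ^+ 2 * t) -
      (s - t) * (m ^+ 2 * cos (m * l) * expR (m ^+ 2 * t)) =
    expR (m ^+ 2 * s) * cos (m * l) - expR (m ^+ 2 * t) * cos (m * l) +
      (s - t) * (expR (m ^+ 2 * t) * (- m ^+ 2 * cos (m * l))) by ring.
  apply=> x /andP[_ x0].
  have -> : m ^+ 2 * (m ^+ 2 * cos (m * l)) * expR (m ^+ 2 * x) =
    m ^+ 4 * (cos (m * l) * expR (m ^+ 2 * x)) by ring.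
  rewrite -[leRHS]mulr1; apply: normrM_le.
    by rewrite ger0_norm// exprn_even_ge0.
  rewrite -[leRHS]mulr1; apply: normrM_le.
    by rewrite ler_norml cos_geN1 cos_le1.
  by rewrite ger0_norm ?expR_ge0// -expR0 ler_expR mulr_ge0_le0// sqr_ge0.
- by move=> t _; rewrite mulr0 sin0 !mulr0.
Qed.

(* With [phi = cos (m l)], [m = (k + 1/2) pi], the pairing
   [z = exp (a t) * int w phi], [a = gamma + m^2], satisfies [z 0 = 0] and
   [z' = +- m exp (a t) w(t, 1)]. If the trace [w(t, 1)] were positive on
   [[-d/2, -d/4]], then [|z (-d)|] would be at least of order [exp (- a d / 2)],
   whereas it is [O(exp (- a d))]. *)
Lemma null_state_trace (gamma : R) (w wx wxx : R -> R -> R) (delta : R) :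
  neumann_heat gamma w wx wxx -> (forall l, 0 <= l <= 1 -> w 0 l = 0) ->
  0 < delta -> ~ (forall t, - delta < t < 0 -> 0 < w t 1).
Proof.
move=> hw w0 delta0 Hpos.
(* The bound [d <= 1] keeps all times in the window of [adjoint_heat]. The interval [[-d/2, -d/4]]
   stays away from [0], where the trace vanishes, so its minimum there is positive. *)
pose d := Num.min delta 1.
have d0 : 0 < d by rewrite lt_min delta0 ltr01.
have d1 : d <= 1 by rewrite ge_min lexx orbT.
have dd : d <= delta by rewrite ge_min lexx.
have d_le0 : - d <= 0 by rewrite oppr_le0 ltW.
have d42 : - (d / 2) < - (d / 4) by lra.
have d40 : - (d / 4) < 0 by lra.
have d2 : - d < - (d / 2) by lra.
have d2_le0 : - (d / 2) <= 0 by lra.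
have d4_le : - d <= - (d / 4) by lra.
have d2_le : - d <= - (d / 2) by exact: ltW.
have w1_gt0 t : - d < t < 0 -> 0 < w t 1.
  by move=> /andP[? ?]; apply: Hpos; apply/andP; split; lra.
have l01 : 0 <= (1 : R) <= 1 by rewrite ler01 lexx.
have cw1 : {within `[- (d / 2), - (d / 4)], continuous (w ^~ 1)}.
  apply: expansion_in_continuous => t; rewrite /= in_itv /= => /andP[_ td].
  have t0 : t <= 0 by lra.
  exists (wxx t 1 - gamma * w t 1) => e e0; have [r r0 Hr] := nh_t hw t0 e0.
  by exists r => // s; rewrite /= in_itv /= => /andP[_ sd] sr; apply: Hr => //; lra.
have d24 : - (d / 2) <= - (d / 4) by lra.
have [xm xmI Hm] := EVT_min d24 cw1.
have m0 : 0 < w xm 1 by apply: Hpos; move: xmI; rewrite in_itv /= => /andP[? ?]; apply/andP; split; lra.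
have {Hm} Hm t : - (d / 2) <= t <= - (d / 4) -> w xm 1 <= w t 1.
  by move=> td; apply: Hm; rewrite in_itv.
move: (w xm 1) m0 Hm => m m0 Hm {xm xmI}.
have [M M0 HM] := within_continuous_bounded ler01 (nh_cont_w hw d_le0).
have md : 0 < m * d ^+ 2 by rewrite mulr_gt0// exprn_gt0.
(* The threshold is read off from the final inequality [m d / 4 + a m d^2 / 8 <= M], which fails
   once [a >= 8 M / (m d^2)]. *)
have [k Hk] : exists k : nat, `|gamma| + 8 * M / (m * d ^+ 2) <= k%:R.
  exists (Num.bound (`|gamma| + 8 * M / (m * d ^+ 2))).
  apply: ltW; apply: archi_boundP; apply: addr_ge0 => //.
  by apply: divr_ge0; rewrite ltW// mulr_gt0.
have hP := cosine_adjoint k; have cosk := cos_half_odd_pi k.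
have mk := half_odd_pi_ge k; move: hP cosk mk; move: (half_odd_pi k) => q hP cosk mk.
have k0 : 0 <= k%:R :> R by [].
have q1 : 1 <= q by lra.
have q0 : 0 < q by lra.
have HZ := expansion_weighted_pairing hw ltr01 (lexx 1) hP.
pose z := weighted_pairing gamma w 1 (fun t l => expR (q ^+ 2 * t) * cos (q * l)).
have sinq : `|sin q| = 1.
  have := cos2Dsin2 q; rewrite cosk expr0n add0r => /eqP.
  by rewrite -real_normK ?num_real// sqrp_eq1// => /eqP.
have sinq0 : sin q != 0 by rewrite -normr_eq0 sinq oner_eq0.
pose a := gamma + q ^+ 2.
(* Since [cos q = 0], this normalization gives [y' = exp (a t) * w(t, 1)] exactly, whatever the sign
   of [sin q]. *)
pose y t := (q * sin q)^-1 * z t.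
have Hy t : -1 <= t <= 0 -> expansion_in `[-1, 0] y t (expR (a * t) * w t 1).
  move=> t01; have := expansion_inZ (q * sin q)^-1 (HZ t t01).
  congr (expansion_in _ _ _ _); rewrite !mulr1 cosk /a mulrDl expRD; field.
  by rewrite sinq0 gt_eqF.
have ak : 8 * M / (m * d ^+ 2) <= a.
  have : q <= q ^+ 2 by rewrite expr2 ler_peMr// ltW.
  have := ler_norm (- gamma); rewrite normrN /a; lra.
have a0 : 0 < a by apply: lt_le_trans ak; rewrite divr_gt0 ?mulr_gt0// exprn_gt0.
have Hmvt s t : - d <= s -> s < t -> t <= 0 ->
    exists2 c, s < c < t & y t - y s = expR (a * c) * w c 1 * (t - s).
  move=> ds st t0; apply: expansion_MVT => // x /andP[sx xt].
  have x01 : -1 <= x <= 0 by apply/andP; split; lra.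
  apply: expansion_inW ltr01 _ (Hy x x01) => v.
  by rewrite /= !in_itv /= => /andP[? ?] _; apply/andP; split; lra.
have y0 : y 0 = 0.
  rewrite /y /z /weighted_pairing (_ : \int[mu]_(l in _) _ = 0) ?mulr0//.
  transitivity (\int[mu]_(l in `[0, 1]) (0 : R)); last by rewrite Rintegral_cst ?mul0r.
  by apply: eq_Rintegral => l; rewrite inE /= in_itv /= => l01'; rewrite w0// mul0r.
(* Of the three increments the outer two are nonnegative and the middle one is bounded below; they
   sum to [- y (- d)]. *)
have [c1 /andP[c11 c12] E1] := Hmvt _ _ (lexx _) d2 d2_le0.
have [c2 /andP[c21 c22] E2] := Hmvt _ _ d2_le d42 (ltW d40).
have [c3 /andP[c31 c32] E3] := Hmvt _ _ d4_le d40 (lexx _).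
have p1 : 0 <= y (- (d / 2)) - y (- d).
  rewrite E1; apply: mulr_ge0; last by rewrite subr_ge0.
  apply: mulr_ge0; rewrite ?expR_ge0// ltW// w1_gt0// c11 (lt_trans c12)//.
  exact: lt_trans d40.
have p3 : 0 <= y 0 - y (- (d / 4)).
  rewrite E3; apply: mulr_ge0; last by rewrite subr_ge0 ltW.
  by apply: mulr_ge0; rewrite ?expR_ge0// ltW// w1_gt0// c32 (le_lt_trans d4_le).
have p2 : expR (- (a * d / 2)) * m * (d / 4) <= y (- (d / 4)) - y (- (d / 2)).
  rewrite E2 (_ : - (d / 4) - - (d / 2) = d / 4); last by field.
  apply: ler_wpM2r; first by rewrite divr_ge0 ?(ltW d0).
  apply: ler_pM; rewrite ?expR_ge0 ?(ltW m0)//.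
    rewrite ler_expR -mulrA -mulrN; apply: ler_wpM2l; exact: ltW.
  by apply: Hm; rewrite !ltW.
have p4 : `|y (- d)| <= expR (- (a * d)) * M.
  rewrite /y /z /weighted_pairing normrM normfV normrM sinq mulr1 (gtr0_norm q0).
  rewrite ler_pdivrMl//; apply: (@le_trans _ _ (expR (- (a * d)) * M)); last first.
    by rewrite ler_peMl// mulr_ge0 ?expR_ge0 ?ltW.
  have -> : expR (- (a * d)) * M = expR (gamma * - d) * (expR (q ^+ 2 * - d) * M * (1 - 0)).
    by rewrite subr0 mulr1 mulrA -expRD; congr (expR _ * _); rewrite /a; ring.
  apply: normrM_le; first by rewrite ger0_norm ?expR_ge0.
  apply: le_Rintegral_cc => //.
    apply: within_continuousM; first exact: nh_cont_w hw _ d_le0.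
    by apply: ah_cont_P hP _ _; rewrite lerN2 d1.
  move=> l l01'; rewrite [X in _ <= X]mulrC; apply: normrM_le; first exact: HM.
  rewrite -[leRHS]mulr1; apply: normrM_le; first by rewrite ger0_norm ?expR_ge0.
  by rewrite ler_norml cos_geN1 cos_le1.
have {p1 p2 p3 p4 E1 E2 E3} key : expR (- (a * d / 2)) * m * (d / 4) <= expR (- (a * d)) * M.
  apply: (le_trans p2); apply: le_trans p4.
  apply: (@le_trans _ _ (- y (- d))); last by rewrite -normrN ler_norm.
  rewrite y0 sub0r oppr_ge0 in p3; rewrite subr_ge0 in p1.
  by rewrite -[leRHS]add0r lerD// lerN2.
(* After this multiplication [exp (a d / 2)] remains on the left only, and [1 + x <= exp x] is
   enough to contradict the choice of [k]. *)
have : expR (a * d) * (expR (- (a * d / 2)) * m * (d / 4)) <= expR (a * d) * (expR (- (a * d)) * M).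
  by rewrite ler_wpM2l ?expR_ge0.
rewrite !mulrA -!expRD addrN expR0 mul1r (_ : a * d - a * d / 2 = a * d / 2); last by field.
have := expR_ge1Dx (a * d / 2); set E := expR _ => HE HEM.
have HEM' : (1 + a * d / 2) * m * (d / 4) <= M.
  apply: (@le_trans _ _ (E * m * (d / 4))); last by rewrite mulrA.
  apply: ler_wpM2r; first by rewrite divr_ge0 ?(ltW d0).
  by apply: ler_wpM2r => //; exact: ltW.
move: ak; rewrite ler_pdivrMr// => ak.
have md1 : 0 < m * d by rewrite mulr_gt0.
have E4 : (1 + a * d / 2) * m * (d / 4) = m * d / 4 + a * (m * d ^+ 2) / 8 by field.
rewrite E4 in HEM'; move: HEM' ak md1.
by move: (a * (m * d ^+ 2)) (m * d) => X Y; clear; lra.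
Qed.

End BoundaryTrace.

(** * Classical heat solutions *)

Section HeatSolutions.
Context {R : realType}.
Local Notation mu := (@lebesgue_measure R).

Lemma has_derive_in_eq (I : set R) (f : R -> R) (t d : R) :
  (forall r : R, 0 < r -> exists2 s, I s & 0 < `|s - t| < r) ->
  has_derive_in I f t d -> derive_in I f t = d.
Proof.
move=> It fd; have : has_derive_in I f t (derive_in I f t) by exact: cvgP fd.
by move=> /has_derive_inP/expansion_in_unique; apply => //; apply/has_derive_inP.
Qed.

Lemma segment_limit_point (a b t : R) : a < b -> a <= t <= b ->
  forall r : R, 0 < r -> exists2 s, `[a, b]%classic s & 0 < `|s - t| < r.
Proof.
move=> ab /andP[a_t tb] r r0.
case: (ltP t b) => [tb'|bt].
  exists (t + Num.min ((b - t) / 2) (r / 2)).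
    rewrite /= in_itv /= (le_trans a_t) /= ?lerDl ?le_min ?divr_ge0 ?subr_ge0 ?(ltW r0)//.
    have : Num.min ((b - t) / 2) (r / 2) <= (b - t) / 2 by rewrite ge_min lexx.
    lra.
  have m0 : 0 < Num.min ((b - t) / 2) (r / 2) by rewrite lt_min !divr_gt0 ?subr_gt0.
  rewrite addrAC subrr add0r gtr0_norm// m0 gt_min; apply/orP; right; lra.
have tb' : t = b by apply/eqP; rewrite eq_le tb bt.
exists (t - Num.min ((b - a) / 2) (r / 2)).
  have m0 : 0 < Num.min ((b - a) / 2) (r / 2) by rewrite lt_min !divr_gt0 ?subr_gt0.
  have : Num.min ((b - a) / 2) (r / 2) <= (b - a) / 2 by rewrite ge_min lexx.
  by rewrite /= in_itv /= tb' => ?; apply/andP; split; lra.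
have m0 : 0 < Num.min ((b - a) / 2) (r / 2) by rewrite lt_min !divr_gt0 ?subr_gt0.
rewrite addrAC subrr add0r normrN gtr0_norm// m0 gt_min; apply/orP; right; lra.
Qed.

Lemma derive_01E (v : R -> R) (l d : R) : 0 <= l <= 1 ->
  expansion_in `[0, 1] v l d -> derive_01 v l = d.
Proof.
move=> l01 /has_derive_inP; apply: has_derive_in_eq.
exact: segment_limit_point ltr01 l01.
Qed.

Lemma supnorm_01_ge0 (v : R -> R) : 0 <= supnorm_01 v.
Proof.
(* For an unbounded [v] the supremum takes its default value [0]. *)
rewrite /supnorm_01; case: (pselect (has_sup [set `|v l| | l in `[0, 1]])) => [hs|/sup_out->//].
apply: le_trans (normr_ge0 (v 0)) _; apply: sup_upper_bound => //.
by exists 0 => //=; rewrite in_itv /= lexx ler01.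
Qed.

(** Continuity makes the set of values bounded, so that [sup] is a genuine upper bound and not the
    default value. *)
Lemma le_supnorm_01 (v : R -> R) (l : R) : {within `[0, 1], continuous v} ->
  0 <= l <= 1 -> `|v l| <= supnorm_01 v.
Proof.
move=> cv l01; have [M M0 HM] := within_continuous_bounded ler01 cv.
apply: ub_le_sup; last by exists l => //=; rewrite in_itv.
by exists M => _ [x /= + <-]; rewrite in_itv /=; exact: HM.
Qed.

Lemma C2norm_01_ge (v : R -> R) (l : R) : {within `[0, 1], continuous v} ->
  {within `[0, 1], continuous (derive_01 v)} -> 0 <= l <= 1 ->
  `|v l| <= C2norm_01 v /\ `|derive_01 v l| <= C2norm_01 v.
Proof.
move=> cv cdv l01; have := le_supnorm_01 cv l01; have := le_supnorm_01 cdv l01.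
have := supnorm_01_ge0 v; have := supnorm_01_ge0 (derive_01 v).
have := supnorm_01_ge0 (derive_01 (derive_01 v)).
by rewrite /C2norm_01; split; lra.
Qed.

(** The C^2 norm of the error [q] of the difference quotients dominates, uniformly in [l], both [q]
    and its first space derivative: the former yields [nh_t], the latter [nh_xt]. *)
Lemma heat_solution_neumann (gamma : R) (u : R -> R) (w : R -> R -> R) :
  heat_solution gamma u w ->
  neumann_heat gamma w (fun t => derive_01 (w t)) (fun t => derive_01 (derive_01 (w t)))
  /\ forall t, t <= 0 -> w t 1 = u t.
Proof.
move=> [[dw [C1 Heq]] _].
have Ex (v : R -> R) l : C2_01 v -> 0 <= l <= 1 -> expansion_in `[0, 1] v l (derive_01 v l).
  by move=> [H _ _] l01; apply/has_derive_inP; apply: H; rewrite in_itv.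
have Exx (v : R -> R) l : C2_01 v -> 0 <= l <= 1 ->
    expansion_in `[0, 1] (derive_01 v) l (derive_01 (derive_01 v) l).
  by move=> [_ H _] l01; apply/has_derive_inP; apply: H; rewrite in_itv.
have wC2 t : t <= 0 -> C2_01 (w t) by move=> /C1[].
have dwC2 t : t <= 0 -> C2_01 (dw t) by move=> /C1[].
pose q s t l := (s - t)^-1 * (w s l - w t l) - dw t l.
have Eq s t l : s <= 0 -> t <= 0 -> 0 <= l <= 1 -> expansion_in `[0, 1] (q s t) l
    ((s - t)^-1 * (derive_01 (w s) l - derive_01 (w t) l) - derive_01 (dw t) l).
  move=> s0 t0 l01; apply: expansion_inB; last exact: Ex (dwC2 _ t0) l01.
  by apply: expansion_inZ; apply: expansion_inB; apply: Ex => //; exact: wC2.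
have Eqx s t l : s <= 0 -> t <= 0 -> 0 <= l <= 1 -> expansion_in `[0, 1] (derive_01 (q s t)) l
    ((s - t)^-1 * (derive_01 (derive_01 (w s)) l - derive_01 (derive_01 (w t)) l)
     - derive_01 (derive_01 (dw t)) l).
  move=> s0 t0 l01.
  have : expansion_in `[0, 1] (fun l => (s - t)^-1 * (derive_01 (w s) l - derive_01 (w t) l)
      - derive_01 (dw t) l) l ((s - t)^-1 *
      (derive_01 (derive_01 (w s)) l - derive_01 (derive_01 (w t)) l)
     - derive_01 (derive_01 (dw t)) l).
    apply: expansion_inB; last exact: Exx (dwC2 _ t0) l01.
    by apply: expansion_inZ; apply: expansion_inB; apply: Exx => //; exact: wC2.
  move=> H e e0; have [r r0 Hr] := H e e0; exists r => // x xI xr.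
  have x01 : 0 <= x <= 1 by move: xI; rewrite /= in_itv.
  by rewrite !(derive_01E _ (Eq _ _ _ s0 t0 _))//; exact: Hr.
have Hq t : t <= 0 -> forall e : R, 0 < e -> exists2 r : R, 0 < r &
    forall s l, s <= 0 -> `|s - t| < r -> 0 <= l <= 1 ->
    `|w s l - w t l - (s - t) * dw t l| <= e * `|s - t| /\
    `|derive_01 (w s) l - derive_01 (w t) l - (s - t) * derive_01 (dw t) l| <= e * `|s - t|.
  move=> t0 e e0; have [_ _ /cvgrPdist_le/(_ e e0) + _] := C1 t t0.
  move=> /nbhs_ballP[r /= r0 H]; exists r => // s l s0 sr l01.
  have [->|st] := eqVneq s t; first by rewrite !subrr !mul0r !subrr normr0 mulr0.
  have bs : ball t r s by rewrite /ball /= distrC.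
  have := H s bs st; rewrite /= in_itv /= => /(_ s0).
  rewrite sub0r normrN => Hs.
  have cq : {within `[0, 1], continuous (q s t)}.
    apply: expansion_in_continuous => x; rewrite /= in_itv /= => x01.
    by eexists; exact: Eq.
  have cqx : {within `[0, 1], continuous (derive_01 (q s t))}.
    apply: expansion_in_continuous => x; rewrite /= in_itv /= => x01.
    by eexists; exact: Eqx.
  have [h1 h2] := C2norm_01_ge cq cqx l01.
  have qe : C2norm_01 (q s t) <= e by apply: le_trans (ler_norm _) Hs.
  have st0 : s - t != 0 by rewrite subr_eq0.
  split.
    have -> : w s l - w t l - (s - t) * dw t l = q s t l * (s - t) by rewrite /q; field.
    by apply: normrM_le => //; exact: le_trans h1 qe.
  have -> : derive_01 (w s) l - derive_01 (w t) l - (s - t) * derive_01 (dw t) l =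
     derive_01 (q s t) l * (s - t).
    by rewrite (derive_01E l01 (Eq _ _ _ s0 t0 l01)); field.
  by apply: normrM_le => //; exact: le_trans h2 qe.
split; last by move=> t /Heq[].
split.
- by move=> t l t0 l01; exact: Ex (wC2 _ t0) l01.
- by move=> t l t0 l01; exact: Exx (wC2 _ t0) l01.
- by move=> t /wC2[].
- move=> t t0 e e0; have [r r0 Hr] := Hq t t0 e e0; exists r => // s l s0 sr l01.
  have [/(_ l) + _ _] := Heq t t0; rewrite in_itv /= => <-//.
  by have [] := Hr s l s0 sr l01.
- by move=> t /Heq[].
- move=> t l t0 l01; exists (derive_01 (dw t) l) => e e0.
  have [r r0 Hr] := Hq t t0 e e0; exists r => // s; rewrite /= in_itv /= => s0 sr.
  by have [] := Hr s l s0 sr l01.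
Qed.

Lemma neumann_heatB (gamma : R) (w wx wxx w' wx' wxx' : R -> R -> R) :
  neumann_heat gamma w wx wxx -> neumann_heat gamma w' wx' wxx' ->
  neumann_heat gamma (fun t l => w t l - w' t l) (fun t l => wx t l - wx' t l)
    (fun t l => wxx t l - wxx' t l).
Proof.
move=> H H'; split.
- by move=> t l t0 l01; apply: expansion_inB; [exact: nh_x H _ _ _ _|exact: nh_x H' _ _ _ _].
- by move=> t l t0 l01; apply: expansion_inB; [exact: nh_xx H _ _ _ _|exact: nh_xx H' _ _ _ _].
- by move=> t t0; apply: within_continuousB; [exact: nh_cont H _ _|exact: nh_cont H' _ _].
- move=> t t0 e e0; have e20 : 0 < e / 2 by rewrite divr_gt0.
  have [r r0 Hr] := nh_t H t0 e20; have [r' r'0 Hr'] := nh_t H' t0 e20.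
  exists (Num.min r r'); first by rewrite lt_min r0.
  move=> s l s0; rewrite lt_min => /andP[sr sr'] l01.
  have -> : w s l - w' s l - (w t l - w' t l) -
      (s - t) * (wxx t l - wxx' t l - gamma * (w t l - w' t l)) =
    (w s l - w t l - (s - t) * (wxx t l - gamma * w t l)) -
    (w' s l - w' t l - (s - t) * (wxx' t l - gamma * w' t l)) by ring.
  have -> : e * `|s - t| = e / 2 * `|s - t| + e / 2 * `|s - t| by field.
  by apply: normrB_le; [exact: Hr|exact: Hr'].
- by move=> t t0; rewrite (nh_neumann H t0) (nh_neumann H' t0) subrr.
- move=> t l t0 l01; have [d Hd] := nh_xt H t0 l01; have [d' Hd'] := nh_xt H' t0 l01.
  by exists (d - d'); exact: expansion_inB.
Qed.

Lemma aeS (P Q : R -> Prop) : (forall x, P x -> Q x) ->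
  {ae mu, forall x, P x} -> {ae mu, forall x, Q x}.
Proof. by move=> PQ [A [mA A0 HA]]; exists A; split=> // x nQ; apply: HA => /PQ. Qed.

(** A positive value would persist on an interval of positive length. The lemma converts almost
    everywhere data on an open interval into estimates up to the endpoints. *)
Lemma continuous_ae_le0 (f : R -> R) (r : R) : 0 < r ->
  {within `[0, r], continuous f} ->
  {ae mu, forall l, `]0, r[%classic l -> f l <= 0} ->
  forall l, 0 <= l <= r -> f l <= 0.
Proof.
move=> r0 cf ae l l0r; rewrite leNgt; apply/negP => fl.
have lI : `[0, r]%classic l by rewrite /= in_itv.
have fl2 : 0 < f l / 2 by rewrite divr_gt0.
have [d d0 Hd] := within_continuous_dist cf lI fl2.
(* Cutting the neighbourhood of [l] to [[0, r]] leaves a nondegenerate interval even when [l] is an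
   endpoint. *)
pose a := Num.max 0 (l - d); pose b := Num.min r (l + d).
have ab : a < b.
  case/andP: l0r => ? ?.
  by rewrite /a /b gt_max !lt_min r0 /=; apply/andP; split; [lra|apply/andP; split; lra].
case: ae => A [mA A0 HA].
have sub : `]a, b[ `<=` A.
  move=> x /=; rewrite in_itv /= gt_max lt_min => /andP[/andP[x0 xl] /andP[xr xld]].
  apply: HA => /=; rewrite in_itv /= x0 xr => /(_ isT) fx.
  have : `|f x - f l| <= f l / 2.
    apply: Hd; first by rewrite /= in_itv /= !ltW.
    by rewrite ltr_norml; apply/andP; split; lra.
  by rewrite ler_norml => /andP[]; lra.
have : (mu `]a, b[ <= mu A)%E by apply: le_measure => //; rewrite inE.
by rewrite A0 lebesgue_measure_itv /= lte_fin ab -EFinB lee_fin subr_le0 leNgt ab.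
Qed.

End HeatSolutions.

(** * Power series *)

Section PowerSeries.
Context {R : realType}.
Implicit Types (a b : nat -> R) (r x : R).

Definition psum a x : R := limn (pseries a x).

(** A substitute for a radius of convergence: it gives convergence for [|x| < r], survives shifts
    and differences, and survives differentiation after shrinking [r]. *)
Definition geom_bounded a r := exists M : R, forall k, `|a k| * r ^+ k <= M.

Lemma cvg_geom_bounded a r : 0 <= r -> cvgn (pseries a r) -> geom_bounded a r.
Proof.
move=> r0 /cvg_series_bounded [K [Kr HK]]; exists (K + 1) => k.
have := HK (K + 1); rewrite ltrDl ltr01 => /(_ isT) H.
by have := H k Logic.I; rewrite /= normrM normrX (ger0_norm r0).
Qed.

Lemma geom_bounded_cvg a r x : geom_bounded a r -> `|x| < r -> cvgn (pseries a x).
Proof.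
move=> [M HM] xr; have r0 : 0 < r by apply: le_lt_trans xr.
apply: normed_cvg; apply: (@series_le_cvg _ _ (geometric M (`|x| / r))).
- by move=> n; rewrite normr_ge0.
- move=> n /=; rewrite mulr_ge0 ?exprn_ge0 ?divr_ge0 ?(ltW r0)//.
  by apply: le_trans (HM 0); rewrite expr0 mulr1.
- move=> n /=; rewrite normrM normrX expr_div_n mulrA ler_pdivlMr ?exprn_gt0//.
  by rewrite mulrAC ler_wpM2r// exprn_ge0.
- apply: is_cvg_geometric_series; rewrite normrM normr_id normfV (gtr0_norm r0).
  by rewrite ltr_pdivrMr// mul1r.
Qed.

Lemma psum_le a r M x : (forall k, `|a k| * r ^+ k <= M) -> 0 < r -> `|x| <= r / 2 ->
  `|psum a x| <= M * 2.
Proof.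
move=> HM r0 xr.
have xr' : `|x| < r by apply: le_lt_trans xr _; rewrite ltr_pdivrMr// ltr_pMr// ltr1n.
have M0 : 0 <= M by apply: le_trans (HM 0); rewrite expr0 mulr1.
have cx : cvgn (pseries a x) by apply: geom_bounded_cvg xr'; exists M.
have bnd n : `|pseries a x n| <= M * 2.
  rewrite /pseries /series /= (le_trans (ler_norm_sum _ _ _))//.
  apply: (@le_trans _ _ (\sum_(0 <= k < n) M * 2^-1 ^+ k)).
    apply: ler_sum => k _; rewrite normrM normrX.
    apply: (@le_trans _ _ (`|a k| * (r / 2) ^+ k)).
      by rewrite ler_wpM2l// lerXn2r ?nnegrE// divr_ge0// ltW.
    by rewrite exprMn mulrA ler_wpM2r// exprn_ge0// invr_ge0.
  rewrite -mulr_sumr ler_wpM2l//.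
  have -> : \sum_(0 <= k < n) (2^-1 : R) ^+ k = 2 - 2 * 2^-1 ^+ n.
    elim: n => [|n IH]; first by rewrite big_nil expr0 mulr1 subrr.
    by rewrite big_nat_recr //= IH exprS; field.
  by rewrite gerBl mulr_ge0// exprn_ge0// invr_ge0.
rewrite ler_norml; apply/andP; split.
  by apply: limr_ge => //; apply: nearW => n; have := bnd n; rewrite ler_norml => /andP[].
by apply: limr_le => //; apply: nearW => n; have := bnd n; rewrite ler_norml => /andP[].
Qed.

Lemma geom_bounded_shift a r : 0 < r -> geom_bounded a r -> geom_bounded (a \o S) r.
Proof.
move=> r0 [M HM]; exists (M / r) => k /=.
by rewrite ler_pdivlMr// -mulrA -exprSr.
Qed.

Lemma psum_shift a r x : geom_bounded a r -> `|x| < r ->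
  psum a x = a 0 + x * psum (a \o S) x.
Proof.
move=> ar xr; have r0 : 0 < r by apply: le_lt_trans xr.
have cb := geom_bounded_cvg (geom_bounded_shift r0 ar) xr.
apply: cvg_lim => //; rewrite -cvg_shiftS /=.
have -> : (fun n => pseries a x n.+1) = (fun n => a 0 + x * pseries (a \o S) x n).
  apply/funext => n; rewrite /pseries /series /= big_nat_recl //= expr0 mulr1.
  by congr (_ + _); rewrite mulr_sumr; apply: eq_bigr => i _; rewrite exprS; ring.
by apply: cvgD; [exact: cvg_cst|apply: cvgMr].
Qed.

(** Removing the constant term and factoring out [x] replaces [a] by its shift and lowers [m] by
    one. *)
Lemma psum_tail (m : nat) a r : 0 < r -> geom_bounded a r -> exists2 C : R, 0 < C &
  forall x, `|x| <= r / 2 -> `|psum a x - \sum_(k < m) a k * x ^+ k| <= C * `|x| ^+ m.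
Proof.
move=> r0; elim: m a => [|m IH] a ar.
  have [M HM] := ar; have M0 : 0 <= M by apply: le_trans (HM 0); rewrite expr0 mulr1.
  exists (M * 2 + 1); first by rewrite ltr_wpDl// mulr_ge0.
  move=> x xr; rewrite big_ord0 subr0 expr0 mulr1 (le_trans (psum_le HM r0 xr))//.
  by rewrite lerDl.
have [C C0 HC] := IH _ (geom_bounded_shift r0 ar); exists C => // x xr.
have xr' : `|x| < r by apply: le_lt_trans xr _; rewrite ltr_pdivrMr// ltr_pMr// ltr1n.
rewrite (psum_shift ar xr') big_ord_recl expr0 mulr1.
have -> : \sum_(i < m) a (lift ord0 i) * x ^+ lift ord0 i =
    x * \sum_(i < m) (a \o S) i * x ^+ i.
  by rewrite mulr_sumr; apply: eq_bigr => i _; rewrite /= exprS /bump /=; ring.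
rewrite opprD addrACA subrr add0r -mulrBr normrM exprS mulrCA.
by apply: ler_wpM2l => //; exact: HC.
Qed.

Lemma psum0 a r : 0 < r -> geom_bounded a r -> psum a 0 = a 0.
Proof.
move=> r0 ar; have x0 : `|0 : R| < r by rewrite normr0.
by rewrite (psum_shift ar x0) mul0r addr0.
Qed.

(** Along zeros tending to [0], the first nonzero term [a m * x^m] cannot be balanced by a tail of
    order [x^(m+1)]. *)
Lemma psum_eq0_coef a r : 0 < r -> geom_bounded a r ->
  (forall e : R, 0 < e -> exists2 x, 0 < `|x| < e & psum a x = 0) ->
  forall k, a k = 0.
Proof.
move=> r0 ar Hz k; apply/eqP; apply: contraT => ak.
have exk : exists k, a k != 0 by exists k.
have [m am minm] := ex_minnP exk => {k ak exk}.
have [C C0 HC] := psum_tail m.+1 r0 ar.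
have am0 : 0 < `|a m| by rewrite normr_gt0.
have [|x /andP[x0]] := Hz (Num.min (r / 2) (`|a m| / C)).
  by rewrite lt_min !divr_gt0.
rewrite lt_min => /andP[xr xC] px.
have := HC x (ltW xr); rewrite px sub0r normrN big_ord_recr /= big1 ?add0r; last first.
  move=> i _; have : a i == 0.
    by apply: contraT => /minm; rewrite leqNgt ltn_ord.
  by move=> /eqP ->; rewrite mul0r.
rewrite normrM normrX exprS mulrA ler_pM2r ?exprn_gt0//.
by rewrite leNgt mulrC -ltr_pdivlMr// xC.
Qed.

Lemma geom_bounded_le a r x : 0 <= x -> x <= r -> geom_bounded a r -> geom_bounded a x.
Proof.
move=> x0 xr [M HM]; exists M => k; apply: le_trans (HM k).
by rewrite ler_wpM2l// lerXn2r// ?nnegrE// (le_trans x0).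
Qed.

(** With [r = (1 + h) x], Bernoulli's inequality bounds the factor [k + 1] by a multiple of
    [(1 + h)^k], which the gap between [x] and [r] absorbs. *)
Lemma geom_bounded_diffs a r x : 0 < x -> x < r -> geom_bounded a r ->
  geom_bounded (pseries_diffs a) x.
Proof.
move=> x0 xr [M HM]; have r0 : 0 < r by exact: lt_trans xr.
pose h := r / x - 1; have h0 : 0 < h by rewrite subr_gt0 ltr_pdivlMr// mul1r.
have bern k : 1 + k%:R * h <= (1 + h) ^+ k.
  elim: k => [|k IH]; first by rewrite mul0r addr0 expr0.
  rewrite exprS -natr1; apply: (@le_trans _ _ ((1 + h) * (1 + k%:R * h))).
    by have := mulr_ge0 (ler0n R k) (sqr_ge0 h); rewrite expr2; lra.
  by rewrite ler_wpM2l// addr_ge0// ltW.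
have hx : r = (1 + h) * x by rewrite /h addrC subrK divfK// gt_eqF.
exists ((1 + h^-1) * (M / r)) => k; rewrite /pseries_diffs normrM ger0_norm//.
have k1 : k.+1%:R <= (1 + h^-1) * (1 + h) ^+ k.
  apply: (@le_trans _ _ ((1 + h^-1) * (1 + k%:R * h))).
    rewrite -natr1 mulrDr mulr1 mulrCA mulrDl mulVf ?gt_eqF// mul1r mulrDr mulr1.
    have := invr_gt0 h; rewrite h0; have := mulr_ge0 (ler0n R k) (ltW h0); lra.
  by rewrite ler_wpM2l// addr_ge0// invr_ge0 ltW.
rewrite -mulrA; apply: (@le_trans _ _ ((1 + h^-1) * (1 + h) ^+ k * (`|a k.+1| * x ^+ k))).
  by rewrite ler_wpM2r// mulr_ge0// exprn_ge0// ltW.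
rewrite -[leLHS]mulrA; apply: ler_wpM2l; first by rewrite addr_ge0// invr_ge0 ltW.
by rewrite mulrCA -exprMn -hx ler_pdivlMr// -mulrA -exprSr.
Qed.

Lemma expansion_psum (I : set R) a r x : geom_bounded a r -> `|x| < r ->
  expansion_in I (psum a) x (psum (pseries_diffs a) x).
Proof.
move=> ar xr; have r0 : 0 < r by apply: le_lt_trans xr.
apply: is_derive_expansion_in.
(* Three equally spaced radii between [|x|] and [r]: each of the two formal derivatives costs one,
   and all three series have to converge at [K 0]. *)
pose K i : R := (`|x| * (3 - i%:R) + r * (1 + i%:R)) / 4.
have x0 := normr_ge0 x.
have K0 : `|x| < K 0%N /\ K 0%N < K 1%N /\ K 1%N < K 2%N /\ K 2%N < r.
  by rewrite /K; split; [|split; [|split]]; lra.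
have [k0 [k1 [k2 k3]]] := K0; have kp : 0 < K 0%N by exact: le_lt_trans k0.
have kp1 : 0 < K 1%N by exact: lt_trans k1.
have kp2 : 0 < K 2%N by exact: lt_trans k2.
have a1 := geom_bounded_diffs kp2 k3 ar.
have a2 := geom_bounded_diffs kp1 k2 a1.
apply: (@pseries_snd_diffs _ _ (K 0%N)).
- apply: geom_bounded_cvg ar _; rewrite gtr0_norm//; lra.
- apply: geom_bounded_cvg a1 _; rewrite gtr0_norm//; lra.
- apply: geom_bounded_cvg a2 _; rewrite gtr0_norm//; lra.
- by rewrite (gtr0_norm kp).
Qed.

Lemma psumB a b r x : geom_bounded a r -> geom_bounded b r -> `|x| < r ->
  psum (fun k => a k - b k) x = psum a x - psum b x.
Proof.
move=> ar br xr; apply: cvg_lim => //.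
have -> : pseries (fun k => a k - b k) x = (fun n => pseries a x n - pseries b x n).
  apply/funext => n; rewrite /pseries /series /= -sumrB.
  by apply: eq_bigr => i _; rewrite mulrBl.
by apply: cvgB; [exact: geom_bounded_cvg ar xr|exact: geom_bounded_cvg br xr].
Qed.

Lemma geom_boundedB a b r : 0 <= r -> geom_bounded a r -> geom_bounded b r ->
  geom_bounded (fun k => a k - b k) r.
Proof.
move=> r0 [M HM] [N HN]; exists (M + N) => k.
apply: le_trans (lerD (HM k) (HN k)); rewrite -mulrDl ler_wpM2r ?exprn_ge0//.
exact: ler_normB.
Qed.

End PowerSeries.

(** * Analytic functions and the backstepping transform *)

Section AnalyticFunctions.
Context {R : realType}.
Implicit Types (a b : nat -> R) (v : R -> R).

Lemma analytic_psum v l0 : analytic_on `[0, 1[ v -> 0 <= l0 < 1 ->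
  exists a r, [/\ 0 < r, l0 + r < 1, geom_bounded a r &
    forall l, 0 <= l < 1 -> `|l - l0| < r -> v l = psum a (l - l0)].
Proof.
move=> Hv /andP[l00 l01]; have [|a [r [r0 Ha]]] := Hv l0; first by rewrite /= in_itv /= l00.
(* Halving keeps [l0 + x] strictly inside both the domain and the disc, so the series converges
   there; this yields the geometric bound. *)
pose x := Num.min r (1 - l0) / 2.
have m0 : 0 < Num.min r (1 - l0) by rewrite lt_min r0 subr_gt0.
have x0 : 0 < x by rewrite divr_gt0.
have xr : x < r by apply: (@lt_le_trans _ _ (Num.min r (1 - l0))); [rewrite /x; lra|rewrite ge_min lexx].
have xl : x < 1 - l0.
  by apply: (@lt_le_trans _ _ (Num.min r (1 - l0))); [rewrite /x; lra|rewrite ge_min lexx orbT].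
exists a, x; split => //; first by lra.
- apply: cvg_geom_bounded; first exact: ltW.
  have := Ha (l0 + x); rewrite /= in_itv /= addrAC subrr add0r (gtr0_norm x0) => H.
  apply: (cvgP (v (l0 + x))); apply: H => //; apply/andP; split; lra.
- move=> l l01' lx; apply/esym/cvg_lim => //; apply: Ha; first by rewrite /= in_itv.
  exact: lt_trans xr.
Qed.

Lemma analytic_onB (I : set R) v v' : analytic_on I v -> analytic_on I v' ->
  analytic_on I (fun l => v l - v' l).
Proof.
move=> Hv Hv' l0 Il0; have [a [r [r0 Ha]]] := Hv l0 Il0.
have [a' [r' [r'0 Ha']]] := Hv' l0 Il0.
exists (fun k => a k - a' k), (Num.min r r'); split; first by rewrite lt_min r0.
move=> l Il; rewrite lt_min => /andP[lr lr'].
have -> : series (fun k => (a k - a' k) * (l - l0) ^+ k) =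
  (fun n => series (fun k => a k * (l - l0) ^+ k) n - series (fun k => a' k * (l - l0) ^+ k) n).
  apply/funext => n; rewrite /series /= -sumrB.
  by apply: eq_bigr => i _; rewrite mulrBl.
by apply: cvgB; [exact: Ha|exact: Ha'].
Qed.

(** Let [s] be the supremum of the points up to which [v] vanishes. Zeros accumulate at [s] from the
    left, so the power series at [s] is zero and the zeros extend beyond [s]. *)
Lemma analytic_identity v (rho : R) : analytic_on `[0, 1[ v -> 0 < rho -> rho <= 1 ->
  (forall l, 0 <= l < rho -> v l = 0) -> forall l, 0 <= l < 1 -> v l = 0.
Proof.
move=> Hv rho0 rho1 v0 l /andP[l0 l1]; apply/eqP; apply: contraT => vl.
pose E := [set x | 0 <= x < 1 /\ forall y, 0 <= y <= x -> v y = 0].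
have El x : E x -> x <= l.
  move=> [_ Ex]; rewrite leNgt; apply/negP => lx.
  by move: vl; rewrite Ex ?eqxx// l0 ltW.
have Erho : E (rho / 2).
  split; first by apply/andP; split; lra.
  by move=> y /andP[y0 yr]; apply: v0; apply/andP; split; lra.
have hE : has_sup E by split; [exists (rho / 2)|exists l].
pose s := sup E.
have s_rho : rho / 2 <= s by exact: sup_upper_bound.
have sl : s <= l by apply: ge_sup; [exists (rho / 2)|exact: El].
have s01 : 0 <= s < 1 by apply/andP; split; lra.
have vs y : 0 <= y < s -> v y = 0.
  move=> /andP[y0 ys]; have := sup_adherent _ hE; move=> /(_ (s - y)).
  rewrite subr_gt0 => /(_ ys)[x [_ Ex]]; rewrite -/s opprB addrC subrK => yx.
  by apply: Ex; rewrite y0 ltW.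
have [a [r [r0 sr ar Ha]]] := analytic_psum Hv s01.
have a0 : forall k, a k = 0.
  apply: (psum_eq0_coef r0 ar) => e e0.
  pose d := Num.min (Num.min r e) s / 2.
  have m0 : 0 < Num.min (Num.min r e) s by rewrite !lt_min r0 e0; lra.
  have : Num.min (Num.min r e) s <= r by rewrite !ge_min lexx.
  have : Num.min (Num.min r e) s <= e by rewrite !ge_min lexx orbT.
  have : Num.min (Num.min r e) s <= s by rewrite !ge_min lexx !orbT.
  rewrite -[Num.min (Num.min r e) s](divfK (_ : 2 != 0))// -/d in m0 * => ds de dr.
  have dE : s - d - s = - d by ring.
  exists (- d); first by rewrite normrN gtr0_norm; lra.
  rewrite -dE -Ha; first by apply: vs; apply/andP; split; lra.
    by apply/andP; split; lra.
  by rewrite dE normrN gtr0_norm; lra.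
have : E (s + r / 2).
  split; first by apply/andP; split; lra.
  move=> y /andP[y0 ysr]; case: (ltP y s) => [ys|sy]; first by rewrite vs// y0.
  rewrite Ha; [|by apply/andP; split; lra|by rewrite ger0_norm ?subr_ge0//; lra].
  rewrite /psum; apply: cvg_lim => //.
  have -> : pseries a (y - s) = cst 0.
    apply/funext => n; rewrite /pseries /series /= big1// => i _.
    by rewrite a0 mul0r.
  exact: cvg_cst.
move=> /(sup_upper_bound hE); rewrite -/s; lra.
Qed.

Lemma eq_expansion_in (I : set R) (f g : R -> R) t d : (forall s, I s -> f s = g s) ->
  I t -> expansion_in I f t d -> expansion_in I g t d.
Proof.
move=> fg It H e e0; have [r r0 Hr] := H e e0; exists r => // s Is sr.
by rewrite -!fg//; exact: Hr.
Qed.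

(** The factor is [(i + j)! / i!], but only its being nonzero matters. *)
Lemma iter_diffs a j : forall i, exists2 c : R, c != 0 &
  iter j (@pseries_diffs R) a i = c * a (i + j)%N.
Proof.
elim: j => [|j IH] i /=; first by exists 1; rewrite ?oner_neq0// addn0 mul1r.
have [c c0 Ec] := IH i.+1; exists (i.+1%:R * c); first by rewrite mulf_neq0// pnatr_eq0.
by rewrite {1}/pseries_diffs Ec mulrA addSnnS.
Qed.

Lemma spaceA_psum v : spaceA v -> exists a r,
  [/\ 0 < r, r < 1, geom_bounded a r, forall k, a k.*2.+1 = 0 &
    forall l, 0 <= l < r -> v l = psum a l].
Proof.
move=> [_ Hv Hodd].
have l01 : 0 <= (0 : R) < 1 by rewrite lexx ltr01.
have [a [r [r0 + ar Ha]]] := analytic_psum Hv l01; rewrite add0r => r1.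
have {}Ha l : 0 <= l < r -> v l = psum a l.
  move=> /andP[l0 lr]; rewrite Ha ?subr0// ?ger0_norm//.
  by rewrite l0 (lt_trans lr).
exists a, r; split => // k.
(* The identity is carried on all of [[0, r[], since the next one-sided derivative looks at nearby
   points. The bounds hold only at radii below [r], as each differentiation shrinks the radius. *)
have main j : (forall x, 0 < x < r -> geom_bounded (iter j (@pseries_diffs R) a) x) /\
    (forall l, 0 <= l < r -> iter j (derive_in `[0, 1[) v l = psum (iter j (@pseries_diffs R) a) l).
  elim: j => [|j [IHb IHv]].
    by split=> // x /andP[x0 xr]; apply: geom_bounded_le ar; rewrite ltW.
  split.
    move=> x /andP[x0 xr]; rewrite iterS.
    apply: (@geom_bounded_diffs _ _ ((x + r) / 2)) => //; first by lra.
    by apply: IHb; apply/andP; split; lra.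
  move=> l /andP[l0 lr]; rewrite !iterS; apply: has_derive_in_eq.
    move=> e e0.
    have [||s sI sle] := @segment_limit_point R 0 ((l + 1) / 2) l _ _ e e0; [lra| |].
      by apply/andP; split; lra.
    exists s => //; move: sI; rewrite /= !in_itv /= => /andP[-> sl] /=; lra.
  apply/has_derive_inP.
  have br : geom_bounded (iter j (@pseries_diffs R) a) ((l + r) / 2).
    by apply: IHb; apply/andP; split; lra.
  have lr' : `|l| < (l + r) / 2 by rewrite ger0_norm//; lra.
  have := expansion_psum `[0, r[%classic br lr'.
  have sub s : `[0, 1[%classic s -> `|s - l| < r - l -> `[0, r[%classic s.
    by rewrite /= !in_itv /= => /andP[-> _]; rewrite ltr_norml => /andP[_]; lra.
  move=> H; apply: expansion_inW sub _; first by rewrite subr_gt0.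
  apply: eq_expansion_in H; last by rewrite /= in_itv /= l0.
  by move=> s; rewrite /= in_itv /= => sr; rewrite IHv.
have [Hb Hl] := main k.*2.+1.
have r2 : 0 < r / 2 < r by apply/andP; split; lra.
have [c c0 Ec] := iter_diffs a k.*2.+1 0.
have := Hodd k; rewrite Hl ?lexx// (psum0 _ (Hb _ r2)); last by case/andP: r2.
by rewrite Ec add0n => /eqP; rewrite mulf_eq0 (negbTE c0) => /eqP.
Qed.

End AnalyticFunctions.

(** * The backstepping kernel near the origin and the expansion of the transform *)

Section Backstepping.
Context {R : realType}.
Local Notation mu := (@lebesgue_measure R).

(** The coefficients of [J_1(s) / s] in powers of [s^2]. In this variable both the exceptional value
    at [s = 0] and the square root in the kernel disappear. *)
Definition bessel_coef (k : nat) : R := (-1) ^+ k / (k`! * (k.+1)`!)%:R / 2 ^+ k.*2.+1.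

(** Comparison with the terms [r^k / k!] of the exponential series. *)
Lemma bessel_coef_bounded (r : R) : 0 <= r -> geom_bounded bessel_coef r.
Proof.
move=> r0; have [K [Kr HK]] := cvg_series_bounded (is_cvg_series_exp_coeff r).
exists (K + 1) => k; have := HK (K + 1); rewrite ltrDl ltr01 => /(_ isT) H.
have Hk : `|r ^+ k / k`!%:R| <= K + 1 := H k Logic.I.
apply: le_trans Hk; rewrite [leRHS]normrM [`|r ^+ k|]ger0_norm ?exprn_ge0//.
rewrite mulrC ler_wpM2l ?exprn_ge0//.
rewrite /bessel_coef !normrM normrX normrN1 expr1n mul1r !normfV !ger0_norm ?exprn_ge0//.
rewrite natrM invfM -mulrA ler_piMr ?invr_ge0// -invfM invf_le1 ?mulr_gt0 ?exprn_gt0 ?ltr0n ?fact_gt0//.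
rewrite -[leLHS]mulr1 ler_pM// ?ler1n ?fact_gt0//.
by rewrite exprn_ege1// ler1n.
Qed.

Lemma besselJ1_ratioE (s : R) : besselJ1_ratio s = psum bessel_coef (s ^+ 2).
Proof.
have s2 : `|s ^+ 2| < s ^+ 2 + 1 by rewrite ger0_norm ?sqr_ge0// ltrDl.
have sp : 0 <= s ^+ 2 + 1 by rewrite addr_ge0// sqr_ge0.
rewrite /besselJ1_ratio; case: eqVneq => [->|s0].
  rewrite expr0n /= (psum0 ltr01 (bessel_coef_bounded ler01)) /bessel_coef.
  by rewrite expr0 !fact0 double0 expr1 muln1 !mul1r invr1 mul1r.
apply: (canLR (mulfK s0)); apply: cvg_lim => //.
rewrite (_ : series _ = (fun n => pseries bessel_coef (s ^+ 2) n * s)).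
  apply: cvgMl; exact: geom_bounded_cvg (bessel_coef_bounded sp) s2.
apply/funext => n; rewrite /pseries /series /= mulr_suml; apply: eq_bigr => k _.
rewrite /bessel_coef expr_div_n -exprM mul2n [s ^+ k.*2.+1]exprSr; ring.
Qed.

Variable c : R.
Hypothesis c0 : 0 < c.

Let arg (l l' : R) : R := c * (l' ^+ 2 - l ^+ 2 + 2 * (l - l')).

(** The argument factors as [c (l - l') (2 - l - l')], nonnegative on the triangle, so squaring
    undoes the square root. *)
Lemma backstepping_kernelE (l l' : R) : 0 <= l' <= l -> l <= 1 ->
  backstepping_kernel c l l' = c * (1 - l) * psum bessel_coef (arg l l')
  /\ 0 <= arg l l' <= 2 * c * l.
Proof.
move=> /andP[l'0 l'l] l1.
have E : l' ^+ 2 - l ^+ 2 + 2 * (l - l') = (l - l') * (2 - l - l') by ring.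
have h1 : 0 <= l - l' by rewrite subr_ge0.
have h2 : 0 <= 2 - l - l' by lra.
have A0 : 0 <= arg l l' by rewrite /arg E mulr_ge0 ?(ltW c0)// mulr_ge0.
rewrite /backstepping_kernel besselJ1_ratioE sqr_sqrtr// A0; split => //=.
rewrite /arg E [2 * c]mulrC -mulrA ler_pM2l//.
by apply: (@le_trans _ _ (l * 2)); [apply: ler_pM; lra|rewrite mulrC].
Qed.

Lemma backstepping_kernel_cont (l : R) : 0 <= l <= 1 ->
  {within `[0, l], continuous (backstepping_kernel c l)}.
Proof.
move=> /andP[l0 l1]; apply: expansion_in_continuous => x xI.
have E1 : expansion_in `[0, l]%classic (arg l) x (c * (2 * x + (2 * (0 - 1)))).
  apply: expansion_inZ; apply: expansion_inD.
    have := expansion_inB (@expansion_exprn R `[0, l]%classic 1 x) (expansion_cst _ (l ^+ 2) x).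
    by congr (expansion_in _ _ _ _); ring.
  by apply: expansion_inZ; apply: expansion_inB; [exact: expansion_cst|exact: expansion_id].
have xp : 0 <= `|arg l x| + 1 by rewrite addr_ge0.
have := expansion_psum setT (bessel_coef_bounded xp) (_ : `|arg l x| < `|arg l x| + 1).
rewrite ltrDl ltr01 => /(_ isT) E2.
have := expansion_inZ (c * (1 - l)) (expansion_in_comp E2 E1) => E3.
eexists; apply: eq_expansion_in xI E3 => s; rewrite /= in_itv /= => sl.
by have [-> _] := backstepping_kernelE sl l1.
Qed.

Lemma backstepping_kernel_near0 : exists C rho : R, [/\ 0 < C, 0 < rho, rho <= 1 &
  forall l l', 0 <= l' <= l -> l <= rho -> `|backstepping_kernel c l l' - c / 2| <= C * l].
Proof.
have [C1 C10 HC1] := psum_tail 1 ltr01 (bessel_coef_bounded ler01).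
(* Then [2 c l <= 1/2], the half radius required by [psum_tail] at radius one. *)
pose rho := Num.min 1 (4 * c)^-1.
exists (c * (2 * C1 * c) + c / 2), rho.
have rho1 : rho <= 1 by rewrite ge_min lexx.
split => //.
- by rewrite addr_gt0// ?mulr_gt0// ?invr_gt0.
- by rewrite lt_min ltr01 invr_gt0 mulr_gt0.
move=> l l' l'l lrho; have l1 : l <= 1 by exact: le_trans rho1.
have l0 : 0 <= l by case/andP: (l'l) => x1 x2; exact: le_trans x1 x2.
have [-> /andP[A0 A1]] := backstepping_kernelE l'l l1.
have lc : 2 * c * l <= 1 / 2.
  have : l <= (4 * c)^-1 by apply: le_trans lrho _; rewrite ge_min lexx orbT.
  rewrite -(ler_pM2l (_ : 0 < 2 * c)) ?mulr_gt0//; move/le_trans; apply.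
  by rewrite le_eqVlt; apply/orP; left; apply/eqP; field; rewrite gt_eqF.
have b0 : bessel_coef 0 = 2^-1.
  by rewrite /bessel_coef expr0 !fact0 double0 expr1 muln1 !mul1r invr1 mul1r.
have := HC1 (arg l l'); rewrite (ger0_norm A0) big_ord1 expr0 mulr1 b0 expr1.
move=> /(_ (le_trans A1 lc)); move: (psum _ _) => B HB.
have -> : c * (1 - l) * B - c / 2 = c * (1 - l) * (B - 2^-1) - c / 2 * l by field.
rewrite mulrDl; apply: normrB_le; last by rewrite ger0_norm// mulr_ge0// divr_ge0// ltW.
rewrite -[c * _ * l]mulrA -mulrA; apply: normrM_le; first by rewrite gtr0_norm.
rewrite -[leRHS]mul1r; apply: normrM_le.
  by rewrite ger0_norm ?subr_ge0// gerBl.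
apply: (le_trans HB); have -> : 2 * C1 * c * l = C1 * (2 * c * l) by ring.
by rewrite ler_wpM2l// ltW.
Qed.

(** The hypothesis at [m.+1] means that [va - vb] has no term of that order; the one in the
    conclusion comes from integrating the leading term against the kernel value [c / 2] at the
    origin. *)
Lemma backstepping_expansion (va vb : R -> R) (a b : nat -> R) (r : R) (m : nat) :
  0 < r -> r < 1 -> geom_bounded a r -> geom_bounded b r ->
  (forall l, 0 <= l < r -> va l = psum a l) ->
  (forall l, 0 <= l < r -> vb l = psum b l) ->
  (forall i, (i < m)%N -> a i = b i) -> a m.+1 = b m.+1 ->
  exists C rho : R, [/\ 0 < rho, rho <= 1 & forall l, 0 < l < rho ->
    `|backstepping c va l - backstepping c vb l - (a m - b m) * l ^+ m
      + c / 2 * (a m - b m) / m.+1%:R * l ^+ m.+1| <= C * l ^+ m.+2].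
Proof.
move=> r0 r1 ar br Hva Hvb Hlt Hm1.
have [C1 [rho1 [C10 rho10 rho11 HK]]] := backstepping_kernel_near0.
have dr := geom_boundedB (ltW r0) ar br.
have [C2 C20 HC2] := psum_tail m.+2 r0 dr.
pose beta := a m - b m; pose v l := va l - vb l.
pose rho := Num.min rho1 (r / 2).
have Hv l : 0 <= l <= r / 2 -> `|v l - beta * l ^+ m| <= C2 * l ^+ m.+2.
  move=> /andP[l0 lr]; have lr' : 0 <= l < r by apply/andP; split; lra.
  have := HC2 l; rewrite (ger0_norm l0) => /(_ lr); rewrite /v Hva// Hvb//.
  have lr'' : `|l| < r by rewrite ger0_norm//; case/andP: lr'.
  rewrite (psumB ar br lr'').
  rewrite !big_ord_recr /= Hm1 subrr mul0r addr0 big1 ?add0r//.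
  by move=> i _; rewrite Hlt// subrr mul0r.
have C30 := ltW C10; have C20' := ltW C20.
exists (C2 + (C1 * (`|beta| + C2) + c / 2 * C2)), rho; split.
- by rewrite lt_min rho10 divr_gt0.
- by rewrite ge_min rho11.
move=> l; rewrite lt_min => /andP[l0 /andP[lrho lr]].
have l1 : l <= 1 by lra.
have l01 : 0 <= l <= 1 by rewrite ltW.
have cK := backstepping_kernel_cont l01.
have cps (f : R -> R) (e : nat -> R) : geom_bounded e r ->
    (forall l, 0 <= l < r -> f l = psum e l) -> {within `[0, l], continuous f}.
  move=> er Hf; apply: expansion_in_continuous => x xI.
  have xl : 0 <= x <= l by move: xI; rewrite /= in_itv.
  have xr : `|x| < r by case/andP: xl => ? ?; rewrite ger0_norm//; lra.
  exists (psum (pseries_diffs e) x).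
  apply: eq_expansion_in xI (expansion_psum _ er xr) => s; rewrite /= in_itv /= => /andP[s0 sl].
  by rewrite Hf// s0 /=; lra.
have cva := cps _ _ ar Hva; have cvb := cps _ _ br Hvb.
have cv : {within `[0, l], continuous v} by exact: within_continuousB.
have iM f : {within `[0, l], continuous f} -> mu.-integrable `[0, l]
    (EFin \o (fun x => backstepping_kernel c l x * f x)).
  by move=> cf; apply: continuous_integrable_cc; exact: within_continuousM.
have E : backstepping c va l - backstepping c vb l =
    v l - \int[mu]_(x in `[0, l]) (backstepping_kernel c l x * v x).
  rewrite /backstepping opprB addrACA -opprB opprK /v.
  have -> : \int[mu]_(x in `[0, l]) (backstepping_kernel c l x * (va x - vb x)) =
      \int[mu]_(x in `[0, l]) (backstepping_kernel c l x * va x) -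
      \int[mu]_(x in `[0, l]) (backstepping_kernel c l x * vb x).
    rewrite -RintegralB//; try exact: iM.
    by apply: eq_Rintegral => x _; rewrite mulrBr.
  ring.
have cX (e : R) : {within `[0, l], continuous (fun x : R => e * x ^+ m)}.
  by apply: within_continuousZ; apply: continuous_subspaceT; exact: exprn_continuous.
have E2 : c / 2 * beta / m.+1%:R * l ^+ m.+1 = \int[mu]_(x in `[0, l]) (c / 2 * beta * x ^+ m).
  rewrite (@Rintegral_expansion R _ (fun x => c / 2 * beta / m.+1%:R * x ^+ m.+1) 0 l)//.
    by rewrite expr0n mulr0 subr0.
  move=> x _.
  have -> : c / 2 * beta * x ^+ m = c / 2 * beta / m.+1%:R * (m.+1%:R * x ^+ m).
    by rewrite mulrA divfK// pnatr_eq0.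
  by apply: expansion_inZ; exact: expansion_exprn.
rewrite E -/beta E2.
have -> : v l - \int[mu]_(x in `[0, l]) (backstepping_kernel c l x * v x) - beta * l ^+ m +
    \int[mu]_(x in `[0, l]) (c / 2 * beta * x ^+ m) =
  (v l - beta * l ^+ m) - \int[mu]_(x in `[0, l])
     (backstepping_kernel c l x * v x - c / 2 * beta * x ^+ m).
  rewrite RintegralB//; first by ring.
    exact: iM.
  exact: continuous_integrable_cc.
rewrite [leRHS]mulrDl; apply: normrB_le; first by apply: Hv; rewrite !ltW.
have -> : (C1 * (`|beta| + C2) + c / 2 * C2) * l ^+ m.+2 =
    (C1 * (`|beta| + C2) + c / 2 * C2) * l ^+ m.+1 * (l - 0).
  by rewrite subr0 [l ^+ m.+2]exprSr mulrA.
apply: le_Rintegral_cc; first exact: ltW.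
  by apply: within_continuousB => //; exact: within_continuousM.
move=> x /[dup] xl /andP[x0 xl'].
have xm i : x ^+ i <= l ^+ i by rewrite lerXn2r ?nnegrE// ltW.
have xr : 0 <= x <= r / 2 by apply/andP; split; lra.
(* The deviation of the kernel from [c / 2] gains one power of [l], that of [v] from its leading
   term gains two, and the integration gains one more. *)
have -> : backstepping_kernel c l x * v x - c / 2 * beta * x ^+ m =
  (backstepping_kernel c l x - c / 2) * v x + c / 2 * (v x - beta * x ^+ m) by ring.
have -> : (C1 * (`|beta| + C2) + c / 2 * C2) * l ^+ m.+1 =
  (C1 * l) * ((`|beta| + C2) * l ^+ m) + c / 2 * (C2 * l ^+ m.+1) by rewrite exprS; ring.
have l_le i : l ^+ i.+1 <= l ^+ i by rewrite exprS ler_piMl// exprn_ge0// ltW.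
have l0' : 0 <= l by exact: ltW.
apply: normrD_le; apply: normrM_le.
- by apply: HK => //; exact: ltW.
- have -> : v x = beta * x ^+ m + (v x - beta * x ^+ m) by ring.
  rewrite [leRHS]mulrDl; apply: normrD_le.
    apply: normrM_le => //; by rewrite ger0_norm ?exprn_ge0.
  apply: (le_trans (Hv x xr)); rewrite ler_wpM2l//.
  by apply: le_trans (xm _) _; apply: le_trans (l_le _) (l_le _).
- by rewrite ger0_norm// divr_ge0// ltW.
- apply: (le_trans (Hv x xr)); rewrite ler_wpM2l//.
  by apply: le_trans (xm _) (l_le _).
Qed.

End Backstepping.

(** * Trajectories *)

Section TrajectoryDerivatives.
Context {R : realType} {n : nat}.

(** Lie derivatives along a trajectory call for two-sided derivatives at time [0] and just before
    it. The forward and backward equations are glued there because [g] and [f] agree on reachable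
    points. *)
Lemma trajectory_local (f g : 'rV[R]_n -> 'rV[R]_n) (X0 : set 'rV[R]_n)
    (X : R -> 'rV[R]_n -> 'rV[R]_n) (x0 : 'rV[R]_n) :
  trajectories f g X0 X -> open X0 -> (forall y, reachable X0 X y -> g y = f y) -> X0 x0 ->
  exists2 eta : R, 0 < eta & forall t, - eta < t ->
    reachable X0 X (X t x0) /\ expansion_in setT (X ^~ x0) t (f (X t x0)).
Proof.
move=> [fwd bwd _] oX0 gf X0x0.
have [[Xx0 Ef] _] := fwd _ X0x0; have [[_ Eb] _] := bwd _ X0x0.
have subX y : X0 y -> reachable X0 X y.
  move=> X0y; have [[X0y0 _] _] := fwd _ X0y.
  by exists 0; [rewrite /= in_itv /= lexx|exists y].
have /nbhs_ballP[e /= e0 He] : nbhs x0 X0 by exact: open_nbhs_nbhs.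
have Eb0 : expansion_in `]-oo, 0] (X ^~ x0) 0 (g (X 0 x0)).
  by apply/has_derive_inP; apply: Eb; rewrite /= in_itv /= lexx.
have e20 : 0 < e / 2 by rewrite divr_gt0.
have [eta eta0 Heta] := expansion_in_cvg Eb0 e20; exists eta => // t teta.
(* [X0] is open, so shortly before time [0] the trajectory is still in [X0], where
   [g = f]. *)
have Xneg : t <= 0 -> X0 (X t x0).
  move=> t0; apply: He; rewrite -ball_normE /ball_ /= -{1}Xx0 distrC.
  apply: (@le_lt_trans _ _ (e / 2)); last by lra.
  apply: Heta; first by rewrite /= in_itv.
  by rewrite subr0 ltr_norml teta (le_lt_trans t0).
have Efwd : 0 <= t -> expansion_in `[0, +oo[ (X ^~ x0) t (f (X t x0)).
  by move=> t0; apply/has_derive_inP; apply: Ef; rewrite /= in_itv /= t0.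
have Ebwd : t <= 0 -> expansion_in `]-oo, 0] (X ^~ x0) t (f (X t x0)).
  move=> t0; rewrite -gf; last by apply: subX; exact: Xneg.
  by apply/has_derive_inP; apply: Eb; rewrite /= in_itv.
have [t0|t0|t0] := ltgtP t 0.
- split; first by apply: subX; apply: Xneg; exact: ltW.
  have nt : 0 < - t by rewrite oppr_gt0.
  apply: (expansion_inW (r := - t) nt _ (Ebwd (ltW t0))).
  by move=> s _; rewrite /= in_itv /= ltr_norml => /andP[_]; lra.
- split; first by exists t; [rewrite /= in_itv /= ltW|exists x0].
  apply: (expansion_inW (r := t) t0 _ (Efwd (ltW t0))).
  by move=> s _; rewrite /= in_itv /= andbT ltr_norml => /andP[? _]; lra.
- split; first by apply: subX; apply: Xneg; rewrite t0.
  have t_ge0 : 0 <= t by rewrite t0.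
  have t_le0 : t <= 0 by rewrite t0.
  move=> d d0; have [r r0 Hr] := Efwd t_ge0 d d0; have [r' r'0 Hr'] := Ebwd t_le0 d d0.
  exists (Num.min r r'); first by rewrite lt_min r0.
  move=> s _; rewrite lt_min => /andP[sr sr']; case: (leP 0 s) => [s0|/ltW s0].
    by apply: Hr => //; rewrite /= in_itv /= s0.
  by apply: Hr' => //; rewrite /= in_itv.
Qed.

Lemma expansion_chain (H : 'rV[R]_n -> R) (phi : R -> 'rV[R]_n) (t : R) (d : 'rV[R]_n) :
  expansion_in setT phi t d -> differentiable H (phi t) ->
  expansion_in setT (fun s => H (phi s)) t ('d H (phi t) d).
Proof.
move=> /is_derive_expansion[dphi phid] dH; apply/is_derive_expansion.
have dp : differentiable phi t by apply/derivable1_diffP.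
have dHp : differentiable (H \o phi) t by exact: differentiable_comp.
apply: DeriveDef; first by apply/derivable1_diffP.
by rewrite -phid (deriveE _ dp) (deriveE _ dHp) diff_comp.
Qed.

Lemma expansion_translate (phi : R -> 'rV[R]_n) (s t : R) (d : 'rV[R]_n) :
  expansion_in setT phi (t + s) d -> expansion_in setT (fun x => phi (x + s)) t d.
Proof.
move=> H e e0; have [r r0 Hr] := H e e0; exists r => // x _ xr.
have xs : x + s - (t + s) = x - t by ring.
by have := Hr (x + s) Logic.I; rewrite xs => /(_ xr).
Qed.

(** The curve is the trajectory of the initial point in [X0], translated in time so that it passes
    through [x] at time [0]. *)
Lemma reachable_curve (f g : 'rV[R]_n -> 'rV[R]_n) (X0 : set 'rV[R]_n)
    (X : R -> 'rV[R]_n -> 'rV[R]_n) (x : 'rV[R]_n) :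
  trajectories f g X0 X -> open X0 -> (forall y, reachable X0 X y -> g y = f y) ->
  reachable X0 X x -> exists (phi : R -> 'rV[R]_n) (eta : R),
  [/\ 0 < eta, phi 0 = x, forall t, t <= 0 -> X t x = phi t &
    forall t, - eta < t -> reachable X0 X (phi t) /\ expansion_in setT phi t (f (phi t))].
Proof.
move=> hX oX0 gf [s + [x0 X0x0 <-]]; rewrite /= in_itv /= andbT => s0.
have [eta eta0 Heta] := trajectory_local hX oX0 gf X0x0.
exists (fun t => X (t + s) x0), eta; split => //.
- by rewrite add0r.
- by move=> t t0; have [_ _ ->] := hX.
- move=> t teta; have ts : - eta < t + s by apply: (lt_le_trans teta); rewrite lerDl.
  have [h1 h2] := Heta _ ts; split => //.
  exact: (@expansion_translate (X ^~ x0)).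
Qed.

Lemma lie_expansion (f : 'rV[R]_n -> 'rV[R]_n) (h : 'rV[R]_n -> R) (phi : R -> 'rV[R]_n)
    (k : nat) (t : R) : expansion_in setT phi t (f (phi t)) ->
  lie_defined f h k.+1 (phi t) ->
  expansion_in setT (fun s => iter k (lie_derive f) h (phi s)) t
    (iter k.+1 (lie_derive f) h (phi t)).
Proof. by move=> Ephi [_ dk]; exact: expansion_chain. Qed.

End TrajectoryDerivatives.

(** * The sign forced by the first nonzero derivative *)

Section FirstNonzeroDerivative.
Context {R : realType}.

(** By the mean value theorem [D 0 t = D 1 c * t] with [t < 0], so each step of the induction
    reverses the sign. Only its constancy is tracked. *)
Lemma first_nonzero_sign (j : nat) (D : nat -> R -> R) (eta : R) : 0 < eta ->
  (forall k t, (k <= j)%N -> - eta < t -> expansion_in setT (D k) t (D k.+1 t)) ->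
  (forall i, (i <= j)%N -> D i 0 = 0) -> D j.+1 0 != 0 ->
  exists2 delta : R, 0 < delta &
    (forall t, - delta < t < 0 -> 0 < D 0 t) \/ (forall t, - delta < t < 0 -> D 0 t < 0).
Proof.
elim: j D => [|j IH] D eta0 HD D0 Dj.
  have E0 : expansion_in setT (D 0) 0 (D 1 0) by apply: HD; rewrite ?oppr_lt0.
  have d0 : 0 < `|D 1 0| / 2 by rewrite divr_gt0// normr_gt0.
  have [r r0 Hr] := E0 _ d0; exists r => //.
  have H t : - r < t < 0 -> `|D 0 t - t * D 1 0| <= `|D 1 0| / 2 * - t.
    move=> /andP[t1 t2]; have := Hr t Logic.I; rewrite subr0 D0// subr0 ltr0_norm//.
    by rewrite ltrNl; apply.
  move: Dj; rewrite neq_lt => /orP[Dn|Dp].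
  - left => t tr; have := H t tr; case/andP: tr => _ t0.
    rewrite (ltr0_norm Dn) ler_norml => /andP[+ _].
    have : 0 < D 1 0 * t by rewrite nmulr_rgt0.
    lra.
  - right => t tr; have := H t tr; case/andP: tr => _ t0.
    rewrite (gtr0_norm Dp) ler_norml => /andP[_].
    have : D 1 0 * t < 0 by rewrite pmulr_rlt0.
    lra.
have [delta delta0 Hd] := IH (D \o S) eta0 (fun k t kj => HD k.+1 t kj) (fun i ij => D0 i.+1 ij) Dj.
pose m := Num.min delta eta.
have mvt t : - m < t < 0 -> exists2 c, t < c < 0 & D 0 t = D 1 c * t.
  move=> /andP[tm t0]; have [|c ct E] := @expansion_MVT R (D 0) (D 1) t 0 t0.
    move=> x /andP[tx x0]; apply: expansion_inW ltr01 _ (HD 0%N x isT _) => //.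
    apply: lt_le_trans tx; apply: le_lt_trans tm; by rewrite lerN2 ge_min lexx orbT.
  by exists c => //; move: E; rewrite D0// !sub0r mulrN => /oppr_inj.
have md : - delta <= - m by rewrite lerN2 ge_min lexx.
exists m; first by rewrite lt_min delta0.
case: Hd => Hd; [right|left] => t tm; have [c /andP[tc c0] ->] := mvt t tm;
  have := Hd c; rewrite /= c0 andbT (le_lt_trans md) ?(lt_trans _ tc)//; try (by case/andP: tm);
  move=> /(_ isT) Dc; case/andP: tm => _ t0.
  by rewrite pmulr_rlt0.
by rewrite nmulr_rgt0.
Qed.

End FirstNonzeroDerivative.

(** * Recovery of the state [v], then of the point [x] *)

Section Injectivity.
Context {R : realType}.
Local Notation mu := (@lebesgue_measure R).

Lemma backstepping_state_inj (gamma c : R) (w wx wxx : R -> R -> R) (va vb : R -> R) :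
  0 < c -> neumann_heat gamma w wx wxx -> spaceA va -> spaceA vb ->
  {ae mu, forall l, `]0, 1[%classic l ->
     w 0 l = backstepping c vb l - backstepping c va l} ->
  forall l, 0 <= l < 1 -> va l = vb l.
Proof.
move=> c0 hw Hva Hvb Hae.
have [a [ra [ra0 ra1 ara aodd Ea]]] := spaceA_psum Hva.
have [b [rb [rb0 rb1 brb bodd Eb]]] := spaceA_psum Hvb.
pose r := Num.min ra rb.
have r0 : 0 < r by rewrite lt_min ra0.
have rra : r <= ra by rewrite ge_min lexx.
have rrb : r <= rb by rewrite ge_min lexx orbT.
have r1 : r < 1 by exact: le_lt_trans ra1.
have ar := geom_bounded_le (ltW r0) rra ara.
have br := geom_bounded_le (ltW r0) rrb brb.
have {}Ea l : 0 <= l < r -> va l = psum a l.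
  by move=> /andP[l0 lr]; rewrite Ea// l0 (lt_le_trans lr).
have {}Eb l : 0 <= l < r -> vb l = psum b l.
  by move=> /andP[l0 lr]; rewrite Eb// l0 (lt_le_trans lr).
suff ab : forall k, a k = b k.
  have HvB : analytic_on `[0, 1[ (fun l => va l - vb l).
    by apply: analytic_onB; [case: Hva|case: Hvb].
  have Hz l : 0 <= l < r -> va l - vb l = 0.
    by move=> lr; rewrite Ea// Eb// (_ : a = b) ?subrr//; apply/funext.
  by move=> l l01; apply/eqP; rewrite -subr_eq0 (analytic_identity HvB r0 (ltW r1) Hz).
move=> k; apply/eqP; apply: contraT => abk.
have exk : exists k, a k != b k by exists k.
have [m abm minm] := ex_minnP exk => {k abk exk}.
(* The first index where the coefficients differ is even, since all odd coefficients vanish on both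
   sides. *)
have mE : m = m./2.*2.
  have := odd_double_half m; case: (odd m) => // /esym mE.
  by move: abm; rewrite mE add1n aodd bodd eqxx.
have [C [rho [rho0 rho1 HC]]] : exists C rho : R, [/\ 0 < rho, rho <= 1 & forall l, 0 < l < rho ->
    `|backstepping c va l - backstepping c vb l - (a m - b m) * l ^+ m
      + c / 2 * (a m - b m) / m.+1%:R * l ^+ m.+1| <= C * l ^+ m.+2].
  apply: (backstepping_expansion c0 r0 r1 ar br Ea Eb).
    by move=> i im; apply/eqP; apply: contraT => /minm; rewrite leqNgt im.
  by rewrite mE aodd bodd.
pose beta' := c / 2 * (a m - b m) / m.+1%:R.
suff : beta' = 0.
  move=> /eqP; rewrite !mulf_eq0 !invr_eq0 !pnatr_eq0 /= !orbF.
  by rewrite (gt_eqF c0) /= subr_eq0 (negbTE abm).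
apply: (@odd_coefficient_eq0 R gamma w wx wxx hw m./2 rho (a m - b m) beta' C) => // l l0r.
rewrite -mE -subr_le0.
have cX (e : R) i : {within `[0, rho], continuous (fun x : R => e * x ^+ i)}.
  by apply: within_continuousZ; apply: continuous_subspaceT; exact: exprn_continuous.
(* The estimate is known only almost everywhere on the open interval; continuity of [F] extends it
   to all of [[0, rho]]. *)
pose F x := `|w 0 x + (a m - b m) * x ^+ m - beta' * x ^+ m.+1| - C * x ^+ m.+2.
suff: F l <= 0 by [].
apply: (@continuous_ae_le0 R F rho) l l0r => //.
  apply: within_continuousB => //; apply: within_continuous_norm.
  apply: within_continuousB => //; apply: within_continuousD => //.
  exact: within_continuousW (nh_cont_w hw _).
apply: aeS Hae => x Hx; rewrite /= in_itv /= => /andP[x0 xr].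
rewrite /F subr_le0 Hx; last by rewrite /= in_itv /= x0 (lt_le_trans xr).
have := HC x; rewrite x0 xr => /(_ isT); rewrite -/beta' -normrN; apply: le_trans.
by rewrite le_eqVlt; apply/orP; left; apply/eqP; congr `|_|; ring.
Qed.

End Injectivity.

Unset Implicit Arguments.

Theorem theorem6p2 (R : realType) (n : nat) (alpha gamma gamma0 : R)
  (f g : 'rV[R]_n -> 'rV[R]_n) (h : 'rV[R]_n -> R)
  (X0 : set 'rV[R]_n) (X : R -> 'rV[R]_n -> 'rV[R]_n)
  (hcont : continuous h)
  (X0open : open X0)
  (hX : trajectories f g X0 X)
  (* the backward field g is chi f in case (1) and f in case (2) *)
  (hcase :
    [/\ bounded_set (reachable X0 X), gamma0 = 0
      & cutoff_field f (reachable X0 X) g] \/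
    [/\ 0 < gamma0, g = f
      & forall x, X0 x -> exists2 C : R, 0 < C &
          forall t : R, t <= 0 -> expR (gamma0 * t) * `|h (X t x)| <= C])
  (hH : exists m : nat,
    (forall k x, (k < m)%N -> reachable X0 X x -> lie_defined f h k x) /\
    set_inj (reachable X0 X) (lie_map f h m))
  (hgamma : gamma0 < gamma)
  (halpha : 0 < alpha + gamma)
  (* well-posedness: the solution w_u exists for u = - h (X t x) *)
  (hw : forall x, reachable X0 X x ->
    exists w, heat_solution gamma (kkl_input h X x) w) :
  forall (xa xb : 'rV[R]_n) (va vb : R -> R),
    reachable X0 X xa -> reachable X0 X xb -> spaceA va -> spaceA vb ->
    observer_map alpha gamma h X xa va = observer_map alpha gamma h X xb vb
      %[ae (@lebesgue_measure R) in `]0, 1[%classic] ->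
    xa = xb /\ va = vb %[ae (@lebesgue_measure R) in `]0, 1[%classic].
Proof.
move=> xa xb va vb Hxa Hxb Hva Hvb Hae.
have gf y : reachable X0 X y -> g y = f y.
  case: hcase => [[_ _ [chi [U [_ [chif _ ->]]]]]|[_ -> _]] // Xy.
  exact: chif.
pose wa := xget (fun _ _ => 0) [set w | heat_solution gamma (kkl_input h X xa) w].
pose wb := xget (fun _ _ => 0) [set w | heat_solution gamma (kkl_input h X xb) w].
have Ha : heat_solution gamma (kkl_input h X xa) wa by have [w Hw] := hw xa Hxa; exact: (xgetI _ Hw).
have Hb : heat_solution gamma (kkl_input h X xb) wb by have [w Hw] := hw xb Hxb; exact: (xgetI _ Hw).
have [Na ua] := heat_solution_neumann Ha; have [Nb ub] := heat_solution_neumann Hb.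
(* Both orders are kept: [null_state_trace] excludes a positive trace only, and the sign to be
   excluded is not known in advance. *)
have Nab := neumann_heatB Na Nb; have Nba := neumann_heatB Nb Na.
have vab : forall l, 0 <= l < 1 -> va l = vb l.
  apply: (backstepping_state_inj halpha Nab Hva Hvb).
  apply: aeS Hae => l Hl /Hl; rewrite /observer_map /kkl_map -/wa -/wb => E.
  by apply/eqP; rewrite subr_eq addrAC eq_sym subr_eq addrC -E addrC.
split; last first.
  by apply: aeS Hae => l _; rewrite /= in_itv /= => /andP[l0 l1]; rewrite vab// ltW.
(* Once [va] and [vb] agree on [[0, 1[], their transforms cancel, and the almost everywhere equality
   of the two heat states extends by continuity to the endpoints. *)
have w0 l : 0 <= l <= 1 -> wa 0 l - wb 0 l = 0.
  move=> l01; apply/eqP; rewrite -normr_le0.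
  apply: (@continuous_ae_le0 R (fun l => `|wa 0 l - wb 0 l|) 1) l l01 => //.
    exact: within_continuous_norm (nh_cont_w Nab (lexx 0)).
  apply: aeS Hae => l Hl /[dup] lI /Hl; rewrite /observer_map /kkl_map -/wa -/wb.
  rewrite (_ : backstepping (alpha + gamma) va l = backstepping (alpha + gamma) vb l).
    by move=> /addIr ->; rewrite subrr normr0.
  move: lI; rewrite /= in_itv /= => /andP[l0 l1].
  rewrite /backstepping vab ?(ltW l0)//; congr (_ - _).
  apply: eq_Rintegral => x; rewrite inE /= in_itv /= => /andP[x0 xl].
  by rewrite vab// x0 (le_lt_trans xl).
have w0' l : 0 <= l <= 1 -> wb 0 l - wa 0 l = 0.
  by move=> l01; rewrite -opprB w0 ?oppr0.
have [m [Hdef Hinj]] := hH.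
have [pa [ea [ea0 pa0 Xa Ea]]] := reachable_curve hX X0open gf Hxa.
have [pb [eb [eb0 pb0 Xb Eb]]] := reachable_curve hX X0open gf Hxb.
pose D k t := iter k (lie_derive f) h (pa t) - iter k (lie_derive f) h (pb t).
have trace t : t <= 0 -> wa t 1 - wb t 1 = - D 0%N t.
  by move=> t0; rewrite ua// ub// /kkl_input Xa// Xb// /D /=; ring.
(* Order zero is read off directly from the null state at [l = 1]; the sign argument handles only
   orders at least one. *)
have D00 : D 0%N 0 = 0.
  by apply/eqP; rewrite -oppr_eq0 -trace// w0// ler01 lexx.
pose eta := Num.min ea eb.
have eta0 : 0 < eta by rewrite lt_min ea0.
(* Differentiability of the [k]-th Lie derivative is part of [lie_defined] at order [k.+1], hence
   the bound on [k.+1]. *)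
have ED k t : (k.+1 < m)%N -> - eta < t -> expansion_in setT (D k) t (D k.+1 t).
  move=> km te.
  have tea : - ea < t by apply: le_lt_trans te; rewrite lerN2 ge_min lexx.
  have teb : - eb < t by apply: le_lt_trans te; rewrite lerN2 ge_min lexx orbT.
  have [Ra Ea'] := Ea t tea; have [Rb Eb'] := Eb t teb.
  by apply: expansion_inB; apply: lie_expansion => //; exact: Hdef.
have Dk0 : forall k, (k < m)%N -> D k 0 = 0.
  (* If order [j.+1] is the first to differ, [D 0] keeps a strict sign just before time [0], and so
     does the trace of the null state, with the opposite sign. *)
  elim/ltn_ind => -[//|j] IH jm; apply/eqP; apply: contraT => Dj.
  have [delta delta0 Hsign] : exists2 delta : R, 0 < delta &
      (forall t, - delta < t < 0 -> 0 < D 0%N t) \/ (forall t, - delta < t < 0 -> D 0%N t < 0).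
    apply: (first_nonzero_sign eta0 _ _ Dj).
      by move=> k t kj te; apply: ED => //; apply: leq_ltn_trans jm.
    by move=> i ij; apply: IH => //; apply: leq_ltn_trans (ltnW jm).
  case: Hsign => Hsign.
    case: (null_state_trace Nba w0' delta0) => t /[dup] tI /Hsign Dt.
    by rewrite -opprB trace ?opprK//; case/andP: tI => _ /ltW.
  case: (null_state_trace Nab w0 delta0) => t /[dup] tI /Hsign Dt.
  by rewrite trace ?oppr_gt0//; case/andP: tI => _ /ltW.
apply: Hinj; rewrite ?inE//; apply/rowP => k; rewrite !mxE.
by have /eqP := Dk0 k (ltn_ord k); rewrite /D pa0 pb0 subr_eq0 => /eqP.
Qed.
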